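(* The adjoints with respect to $\langle\cdot,\cdot\rangle$ of the difference-reflection operators $T_0,T_1$ and of the Cherednik-Dunkl operator $Y=T_1T_0$ exist. More precisely, $T_i^*=(T_i')^{-1}$ for $i=0,1$ and $Y^*=(Y')^{-1}$; that is, for all $f,g\in\mathcal A$, $$\langle T_if,g\rangle=\langle f,(T_i')^{-1}g\rangle\ (i=0,1),\qquad \langle Yf,g\rangle=\langle f,(Y')^{-1}g\rangle .$$
   Context: Parameters: $q\in\mathbb C$ with $0<|q|<1$ and a fixed square root $q^{1/2}$; $\underline t=(k_0,k_1,u_0,u_1)$ nonzero complex numbers with $k_0^2,k_1^2,u_1^2\notin\{\pm q^j:j\in\mathbb Z\}$. Set $a=k_1u_1$, $b=-k_1u_1^{-1}$, $c=q^{1/2}k_0u_0$, $d=-q^{1/2}k_0u_0^{-1}$ and assume $ef\notin q^{\mathbb Z}$ for all $e,f\in\{a,b,c,d\}$ (including $e=f$). $\mathcal A=\mathbb C[x^{\pm1}]$. Define linear operators on $\mathcal A$ by $(T_1f)(x)=k_1f(x)+k_1^{-1}\frac{(1-k_1u_1x)(1+k_1u_1^{-1}x)}{1-x^2}\bigl(f(x^{-1})-f(x)\bigr)$ and $(T_0f)(x)=k_0f(x)+k_0^{-1}\frac{(1-q^{1/2}k_0u_0x^{-1})(1+q^{1/2}k_0u_0^{-1}x^{-1})}{1-qx^{-2}}\bigl(f(qx^{-1})-f(x)\bigr)$; they satisfy $(T_i-k_i)(T_i+k_i^{-1})=0$, hence are invertible. $Y=T_1T_0$. The operators $T_0',T_1'$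 are given by the same formulas with $k_0,k_1,u_0,u_1,q,q^{1/2}$ all replaced by their inverses, and $Y'=T_1'T_0'$. $(y;q)_\infty=\prod_{j\ge0}(1-yq^j)$ and $(y_1,\dots,y_r;q)_\infty=\prod_i(y_i;q)_\infty$. The bilinear form is $$\langle f,g\rangle=\frac1{2\pi i}\int_{C}f(x)g(x^{-1})\Delta(x)\frac{dx}{x},\qquad \Delta(x)=\frac{(x^2,qx^{-2};q)_\infty}{(ax,bx,cx,dx,qax^{-1},qbx^{-1},cx^{-1},dx^{-1};q)_\infty},$$ where $C$ is a counterclockwise continuous rectifiable Jordan curve such that $aq^k,bq^k,cq^k,dq^k$ ($k\in\mathbb Z_{\ge0}$) (and hence $0$) lie in its interior and $a^{-1}q^{-k},b^{-1}q^{-k},c^{-1}q^{-k},d^{-1}q^{-k}$ ($k\in\mathbb Z_{\ge0}$) lie in its exterior. An adjoint of a linear endomorphism $T$ of $\mathcal A$ is a linear endomorphism $T^*$ with $\langle Tf,g\rangle=\langle f,T^*g\rangle$ for all $f,g\in\mathcal A$. *)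

(* Defs.v *)
From HB Require Import structures.
From mathcomp Require Import all_boot all_order all_algebra.
From mathcomp Require Import finmap.
From mathcomp Require Import all_classical all_reals all_analysis.
From mathcomp.real_closed Require Import complex.
(* The notations of monalg clash with those of mathcomp-analysis. *)
From mathcomp Require Export -(notations) monalg.
From mathcomp Require Import ring.

Set Implicit Arguments.
Unset Strict Implicit.
Unset Printing Implicit Defensive.

Import Order.TTheory GRing.Theory Num.Theory numFieldNormedType.Exports.

Local Open Scope classical_set_scope.
Local Open Scope ring_scope.

(* Laurent polynomials C[x, x^-1]: finitely supported families of complex
   coefficients indexed by the exponents in int. *)
Notation laurent R := (malg int (complex R)).

Section Laurent.
Variable R : realType.
Local Notation C := (complex R).
Implicit Types (f g h : laurent R) (x c : C).

Definition ev f x : C := \sum_(n <- msupp f) mcoeff n f * x ^ n.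

Lemma evEw f (E : {fset int}) x : (msupp f `<=` E)%fset ->
  ev f x = \sum_(n <- E) mcoeff n f * x ^ n.
Proof.
move=> sfE; rewrite /ev; apply: big_fset_incl => // n _ nf.
by rewrite mcoeff_outdom// mul0r.
Qed.

Lemma ev_linear x : linear (ev^~ x : laurent R -> C^o).
Proof.
move=> c f g; set E := (msupp f `|` msupp g)%fset.
have sE : (msupp (c *: f + g) `<=` E)%fset.
  apply: (fsubset_trans (msuppD_le _ _)).
  by rewrite fsetSU// msuppZ_le.
rewrite (evEw _ sE) (evEw x (fsubsetUl (msupp f) (msupp g))).
rewrite (evEw x (fsubsetUr (msupp f) (msupp g))).
rewrite scaler_sumr -big_split/=; apply: eq_bigr => n _.
by rewrite mcoeffD mcoeffZ mulrDl scalerAl.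
Qed.

Lemma evD f g x : ev (f + g) x = ev f x + ev g x.
Proof. by have := ev_linear x 1 f g; rewrite !scale1r. Qed.

Lemma ev0 x : ev 0 x = 0.
Proof. by have := evD 0 0 x; rewrite addr0 -{1}[ev 0 x]addr0 => /addrI/esym. Qed.

Lemma evZ c f x : ev (c *: f) x = c * ev f x.
Proof. by have := ev_linear x c f 0; rewrite !addr0 ev0 addr0. Qed.

Lemma evU c (n : int) x : ev (mkmalgU n c) x = c * x ^ n.
Proof. by rewrite (evEw x (msuppU_le : (_ `<=` [fset n])%fset)) big_seq_fset1 mcoeffUU. Qed.

Lemma ev_inj_off c f g :
  (forall x, x != 0 -> x ^+ 2 != c -> ev f x = ev g x) -> f = g.
Proof.
move=> fg; apply/eqP; rewrite -subr_eq0 -scaleN1r; apply/eqP.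
set h := f + _.
have h0 x : x != 0 -> x ^+ 2 != c -> ev h x = 0.
  by move=> x0 xc; rewrite /h evD evZ fg// mulN1r subrr.
clearbody h; clear fg f g.
pose N := \max_(n <- msupp h) `|n|%N.
have NP n : n \in msupp h -> (`|n| <= N)%N.
  by move=> nh; apply: (@leq_bigmax_seq int (enum_fset (msupp h)) xpredT absz n nh).
pose p : {poly C} := \sum_(n <- msupp h) mcoeff n h *: 'X^(absz (n + N%:Z)).
have absN n : n \in msupp h -> (absz (n + N%:Z))%:Z = n + N%:Z.
  move=> /NP nN; apply: gez0_abs.
  have : - n <= `|n|%N%:Z by rewrite abszE ler_normr lexx orbT.
  by rewrite -subr_ge0 opprK addrC => /le_trans; apply; rewrite lerD2l lez_nat.
have pE x : x != 0 -> p.[x] = x ^ N%:Z * ev h x.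
  move=> x0; rewrite /p /ev horner_sum mulr_sumr big_seq [RHS]big_seq.
  apply: eq_bigr => n nh.
  rewrite hornerZ hornerXn mulrCA; congr (_ * _).
  by rewrite -[x ^+ _]/(x ^ (absz (n + N%:Z))%:Z) absN// expfzDr// mulrC.
pose P := p * 'X * ('X^2 - c%:P).
have P0 : P = 0.
  apply: (@roots_geq_poly_eq0 _ _ [seq i%:R | i <- iota 0 (size P)]).
  - apply/allP => x _; rewrite /P /root !hornerE.
    have [->|x0] := eqVneq x 0; first by rewrite mulr0 mul0r.
    have [->|xc] := eqVneq (x ^+ 2) c; first by rewrite subrr mulr0.
    by rewrite pE// h0// mulr0 !mul0r.
  - by rewrite map_inj_uniq ?iota_uniq//; exact: (mulrIn (oner_neq0 _)).
  - by rewrite size_map size_iota.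
have p0 : p = 0.
  move/eqP: P0; rewrite /P !mulf_eq0 polyX_eq0 orbF => /orP[/eqP//|].
  by rewrite (negbTE (monic_neq0 (monicXnsubC c (isT : (0 < 2)%N)))).
apply/malgP => n; rewrite mcoeff0; apply/eqP; case: (boolP (n \in msupp h)) => [nh|]; last by rewrite -mcoeff_eq0.
have := congr1 (fun p : {poly C} => p`_(absz (n + N%:Z))) p0.
rewrite coef0 /p coef_sum (big_fsetD1 n)//= coefZ coefXn eqxx mulr1.
rewrite big_seq big1 ?addr0 => [->|m]; first by rewrite ?eqxx.
rewrite in_fsetD1 => /andP[mn mh]; rewrite coefZ coefXn.
case: eqP => [e|]; last by rewrite mulr0.
have : n + N%:Z = m + N%:Z by rewrite -absN// e absN.
by move=> /addIr enm; rewrite enm eqxx in mn.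
Qed.


(* Laurent polynomial functions on the nonzero complex numbers. *)
Definition is_laurent (F : C -> C) := exists h, forall x, x != 0 -> ev h x = F x.

Lemma is_laurent_ext F G :
  (forall x, x != 0 -> F x = G x) -> is_laurent F -> is_laurent G.
Proof. by move=> FG [h hF]; exists h => x x0; rewrite hF// FG. Qed.

Lemma is_laurent_ev f : is_laurent (ev f).
Proof. by exists f. Qed.

Lemma is_laurent_exp (n : int) : is_laurent (fun x => x ^ n).
Proof. by exists (mkmalgU n 1) => x _; rewrite evU mul1r. Qed.

Lemma is_laurentD F G :
  is_laurent F -> is_laurent G -> is_laurent (fun x => F x + G x).
Proof. by move=> [f fF] [g gG]; exists (f + g) => x x0; rewrite evD fF// gG. Qed.

Lemma is_laurentZ c F : is_laurent F -> is_laurent (fun x => c * F x).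
Proof. by move=> [f fF]; exists (c *: f) => x x0; rewrite evZ fF. Qed.

Lemma is_laurent_sum (I : Type) (r : seq I) (F : I -> C -> C) :
  (forall i, is_laurent (F i)) -> is_laurent (fun x => \sum_(i <- r) F i x).
Proof.
move=> LF; elim: r => [|i r IH].
  by exists 0 => x _; rewrite ev0 big_nil.
apply: is_laurent_ext (is_laurentD (LF i) IH) => x _.
by rewrite big_cons.
Qed.

Lemma is_laurentX (n : int) F : is_laurent F -> is_laurent (fun x => x ^ n * F x).
Proof.
move=> [f fF].
have : is_laurent (fun x => \sum_(m <- msupp f) (mcoeff m f * x ^ (n + m))).
  by apply: is_laurent_sum => m; apply/is_laurentZ/is_laurent_exp.
apply: is_laurent_ext => x x0; rewrite -fF// /ev mulr_sumr.
by apply: eq_bigr => m _; rewrite expfzDr// mulrCA.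
Qed.

Lemma is_laurent_reflect c (n : int) : c != 0 -> exists2 H, is_laurent H &
  forall x, x != 0 -> (1 - c / x ^+ 2) * H x = (c / x) ^ n - x ^ n.
Proof.
move=> c0.
have nat_case (m : nat) : exists2 H, is_laurent H &
    forall x, x != 0 -> (1 - c / x ^+ 2) * H x = (c / x) ^+ m - x ^+ m.
  exists (fun x => -1 * (x ^ m%:Z * \sum_(i < m) c ^+ i * x ^ (- (2 * i)%N%:Z))).
    apply/is_laurentZ/is_laurentX/is_laurent_sum => i.
    exact/is_laurentZ/is_laurent_exp.
  move=> x x0; set y := c / x ^+ 2.
  have -> : c / x = x * y by rewrite /y; field.
  rewrite (eq_bigr (fun i : 'I_m => y ^+ i)); last first.
    move=> i _; rewrite /y exprMn exprVn -exprM; congr (_ * _).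
    by rewrite exprnN.
  have yS := subrX1 y m; set S := \sum_(i < m) _ in yS *.
  transitivity (x ^+ m * ((y - 1) * S)); first by rewrite -exprnP; ring.
  by rewrite -yS (exprMn m x y); ring.
case: n => m; first exact: nat_case.
have [H LH HE] := nat_case m.+1.
exists (fun x => - (c ^- m.+1) * H x); first exact: is_laurentZ.
move=> x x0; rewrite mulrCA HE// !NegzE -!exprnN exprMn exprVn invfM invrK.
have : c ^+ m.+1 != 0 by rewrite expf_neq0.
have : x ^+ m.+1 != 0 by rewrite expf_neq0.
by move: (x ^+ _) (c ^+ _) => X D X0 D0; field; rewrite X0.
Qed.

Lemma is_laurent_divdiff c f : exists2 H, is_laurent H &
  forall x, x != 0 -> x ^+ 2 != c ->
    H x = (ev f (c / x) - ev f x) / (1 - c / x ^+ 2).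
Proof.
have [->|c0] := eqVneq c 0.
  exists (fun x => ev f 0 * x ^ 0 + (-1) * ev f x).
    by apply: is_laurentD; apply: is_laurentZ;
      [exact: is_laurent_exp|exact: is_laurent_ev].
  by move=> x _ _; rewrite !mul0r subr0 divr1 expr0z mulr1 mulN1r.
pose H n := projT1 (cid2 (is_laurent_reflect n c0)).
have LH n : is_laurent (H n) by rewrite /H; case: cid2.
have HE n x : x != 0 -> (1 - c / x ^+ 2) * H n x = (c / x) ^ n - x ^ n.
  by rewrite /H; case: cid2 => /= G _; apply.
exists (fun x => \sum_(n <- msupp f) mcoeff n f * H n x).
  by apply: is_laurent_sum => n; exact: is_laurentZ.
move=> x x0 xc; have d0 : 1 - c / x ^+ 2 != 0.
  by rewrite subr_eq0 eq_sym -subr_eq0 -[1](divff (expf_neq0 2 x0)) -mulrBl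
    mulf_neq0// ?invr_eq0 ?expf_neq0// subr_eq0 eq_sym.
apply: (canRL (mulfK d0)); rewrite mulrC mulr_sumr /ev -sumrB.
by apply: eq_bigr => n _; rewrite mulrCA HE// mulrBr.
Qed.

(* The formula defining T1 f makes sense only away from x = 1, -1; T1 f is the
   unique Laurent polynomial agreeing with it there (T1P, ev_inj_off). *)
Definition T1 (k u : C) f : laurent R :=
  xget 0 [set h | forall x, x != 0 -> x ^+ 2 != 1 ->
    ev h x = k * ev f x
      + k^-1 * ((1 - k * u * x) * (1 + k * u^-1 * x) / (1 - x ^+ 2))
        * (ev f x^-1 - ev f x)].

(* s stands for the chosen square root of q. *)
Definition T0 (s q k u : C) f : laurent R :=
  xget 0 [set h | forall x, x != 0 -> x ^+ 2 != q ->
    ev h x = k * ev f x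
      + k^-1 * ((1 - s * k * u * x^-1) * (1 + s * k * u^-1 * x^-1)
                / (1 - q * x ^- 2))
        * (ev f (q * x^-1) - ev f x)].

Lemma T1P k u f x : x != 0 -> x ^+ 2 != 1 ->
  ev (T1 k u f) x = k * ev f x
    + k^-1 * ((1 - k * u * x) * (1 + k * u^-1 * x) / (1 - x ^+ 2))
      * (ev f x^-1 - ev f x).
Proof.
rewrite /T1; case: xgetP => [h _ /(_ x)//|]; set A := [set _ | _] => A0.
exfalso; have [H LH HE] := is_laurent_divdiff 1 f.
have : is_laurent (fun x => k * ev f x + k^-1 * (- (x ^ (-2) * H x)
    + (k * u - k * u^-1) * (x ^ (-1) * H x) + (k * u * (k * u^-1)) * H x)).
  apply: is_laurentD; first exact/is_laurentZ/is_laurent_ev.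
  apply/is_laurentZ/is_laurentD; last exact/is_laurentZ.
  apply: is_laurentD; last exact/is_laurentZ/is_laurentX.
  apply: is_laurent_ext (is_laurentZ (-1) (is_laurentX (-2) LH)) => y _.
  by rewrite mulN1r.
move=> [h hE]; apply: (A0 h) => y y0 y1; rewrite hE// HE// div1r.
have d0 : 1 - y ^+ 2 != 0 by rewrite subr_eq0 eq_sym.
have d1 : y ^+ 2 - 1 != 0 by rewrite subr_eq0.
rewrite -!exprnN; move: (k^-1) (u^-1) => k' u'.
by field; rewrite y0 d0 d1.
Qed.

Lemma T0P s q k u f x : x != 0 -> x ^+ 2 != q ->
  ev (T0 s q k u f) x = k * ev f x
    + k^-1 * ((1 - s * k * u * x^-1) * (1 + s * k * u^-1 * x^-1)
              / (1 - q * x ^- 2))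
      * (ev f (q * x^-1) - ev f x).
Proof.
rewrite /T0; case: xgetP => [h _ /(_ x)//|]; set A := [set _ | _] => A0.
exfalso; have [H LH HE] := is_laurent_divdiff q f.
have : is_laurent (fun x => k * ev f x + k^-1 * (H x
    + (s * k * u^-1 - s * k * u) * (x ^ (-1) * H x)
    + (- (s * k * u * (s * k * u^-1))) * (x ^ (-2) * H x))).
  apply: is_laurentD; first exact/is_laurentZ/is_laurent_ev.
  apply/is_laurentZ/is_laurentD; last exact/is_laurentZ/is_laurentX.
  by apply: is_laurentD => //; exact/is_laurentZ/is_laurentX.
move=> [h hE]; apply: (A0 h) => y y0 y1; rewrite hE// HE//.
have -> : y ^ (-2) = y^-1 ^+ 2 by rewrite exprVn.
have -> : y ^ (-1) = y^-1 by [].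
move: (1 - q * _)^-1 (_ - ev f y) => E D.
move: (k^-1) (u^-1) (y^-1) => k' u' y'.
ring.
Qed.

Fact T1_linear k u : linear (T1 k u).
Proof.
move=> c f g; apply: (@ev_inj_off 1) => x x0 x1.
by rewrite !(evD, evZ, T1P)//; ring.
Qed.

Fact T0_linear s q k u : linear (T0 s q k u).
Proof.
move=> c f g; apply: (@ev_inj_off q) => x x0 x1.
by rewrite !(evD, evZ, T0P)//; ring.
Qed.

HB.instance Definition _ k u :=
  GRing.isLinear.Build C (laurent R) (laurent R) *:%R (T1 k u) (T1_linear k u).
HB.instance Definition _ s q k u :=
  GRing.isLinear.Build C (laurent R) (laurent R) *:%R (T0 s q k u)
    (T0_linear s q k u).

End Laurent.

Section ContourIntegral.
Variable R : realType.
Local Notation C := (complex R).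
(* C^o carries the topology of the absolute value. *)
Implicit Types (gamma : R -> C^o) (F : C -> C).

(* Paths are parametrized by [0, 1]; as for realfun.variation, a partition
   0 < t_1 < ... < t_n = 1 is represented by [:: t_1; ...; t_n]. *)
Definition subdiv (p : seq R) : nat -> R := nth 1 (0 :: p).

Definition rectifiable gamma := exists L : R, forall p, itv_partition 0 1 p ->
  \sum_(0 <= n < size p) `|gamma (subdiv p n.+1) - gamma (subdiv p n)| <= L%:C%C.

Definition jordan_curve gamma :=
  [/\ {within `[0, 1], continuous gamma},
      gamma 0 = gamma 1,
      {in `[0, 1[ &, injective gamma}
    & rectifiable gamma].

Definition riemann_stieltjes_sum gamma F (p : seq R) (tag : nat -> R) : C :=
  \sum_(0 <= n < size p)
    F (gamma (tag n)) * (gamma (subdiv p n.+1) - gamma (subdiv p n)).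

Definition is_contour_integral gamma F (I : C) :=
  forall e : R, 0 < e -> exists2 d : R, 0 < d &
    forall (p : seq R) (tag : nat -> R), itv_partition 0 1 p ->
      (forall n, (n < size p)%N ->
        subdiv p n.+1 - subdiv p n < d /\
        subdiv p n <= tag n <= subdiv p n.+1) ->
      `|riemann_stieltjes_sum gamma F p tag - I| < e%:C%C.

Definition contour_integral gamma F : C := xget 0 (is_contour_integral gamma F).

Definition two_pi_i : C := 2 * (pi : R)%:C%C * 'i%C.

Definition winding_number gamma (w : C) : C :=
  two_pi_i^-1 * contour_integral gamma (fun z => (z - w)^-1).

Definition curve_image gamma : set C^o := gamma @` `[0, 1].

Definition jordan_interior gamma : set C^o :=
  [set w | ~ curve_image gamma w /\ bounded_set (connected_component (~` curve_image gamma) w)].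

Definition jordan_exterior gamma : set C^o :=
  [set w | ~ curve_image gamma w /\ ~ bounded_set (connected_component (~` curve_image gamma) w)].

Definition counterclockwise gamma :=
  forall w, jordan_interior gamma w -> winding_number gamma w = 1.

End ContourIntegral.

Section BilinearForm.
Variable R : realType.
Local Notation C := (complex R).

Definition qpoch (q y : C) : C := limn (fun n => \prod_(j < n) (1 - y * q ^+ j) : C^o).

Definition qpochs (q : C) (ys : seq C) : C := \prod_(y <- ys) qpoch q y.

Definition weight (q a b c d x : C) : C :=
  qpochs q [:: x ^+ 2; q * x ^- 2]
  / qpochs q [:: a * x; b * x; c * x; d * x;
                 q * a * x^-1; q * b * x^-1; c * x^-1; d * x^-1].

Definition pairing (q a b c d : C) (gamma : R -> C^o) (f g : laurent R) : C :=
  (two_pi_i R)^-1 * contour_integral gamma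
    (fun x => ev f x * ev g x^-1 * weight q a b c d x / x).

Definition is_adjoint (B : laurent R -> laurent R -> C)
    (T S : {linear laurent R -> laurent R}) :=
  forall f g, B (T f) g = B f (S g).

Definition is_inverse (T S : {linear laurent R -> laurent R}) :=
  cancel T S /\ cancel S T.

End BilinearForm.

(* Main.v *)
(* The integrand of <T f, g> - <f, T'^-1 g> is a constant multiple of
   K(x) (h(x) - h(p/x)) / x, where p = 1, h(x) = f(x) g(x) for T_1,
   p = q, h(x) = f(x) g(x/q) for T_0, and the kernel K is invariant under x -> p/x.
   Truncating the q-Pochhammer symbols in K gives rational functions that keep this
   invariance and converge uniformly on the curve. For a rational G, partial fractions
   reduce the vanishing of the integral of (G(x) - G(p/x)) / x to two cases: for G = x^n
   the integrand has no term in 1/x, hence a primitive; for G = (x - r)^-m exactly one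
   of r and p/r is enclosed by the curve, and both halves have the same integral. *)

Require Import Defs.
From mathcomp Require Import all_boot all_order all_algebra.
From mathcomp Require Import all_classical all_reals all_analysis.
From mathcomp.real_closed Require Import complex.
From mathcomp Require Import ring lra.

Set Implicit Arguments.
Unset Strict Implicit.
Unset Printing Implicit Defensive.

Import Order.TTheory GRing.Theory Num.Theory numFieldNormedType.Exports.

Local Open Scope classical_set_scope.
Local Open Scope ring_scope.

(** * Families asymptotic along a filter *)

(** The quadratic relation makes the inverse of T_i' explicit: it is T_i' + (k_i - k_i^-1). With
    this form the coefficients of f(x) g(1/x) on the two sides agree, and only h(x) - h(p/x)
    survives. The factor (1 - a x)(1 - b x)/(1 - x^2) of [T1] strips the first factors from (a x, b
    x; q) and (x^2; q) in the weight, and the factor of [T0] does the same with c/x, d/x and q/x^2;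
    this is what makes the remaining kernel invariant. The zeros of its denominators come in pairs e
    p q^j, 1/(e q^j), one inside the curve and one outside, exchanged by x -> p/x. Truncation is
    forced because the points e p q^j accumulate at 0, inside the curve. No Cauchy theorem is
    invoked: integrals are obtained from primitives, geometric series and uniform limits, and the
    winding number 0 outside comes from connectedness of the exterior component. *)

Section Asymptotic.
Variables (K : numFieldType) (W : Type) (F : set_system W).
Context {FF : Filter F}.
Implicit Types u v : W -> K.

Definition bounded_along u := exists2 M : K, 0 < M & \forall w \near F, `|u w| <= M.

(** Both families may vary with w, so this replaces convergence to a limit. The two boundedness
    clauses make the relation stable under products. Over the complex numbers, [0 < e] already says
    that e is a positive real. *)
Definition asymptotic u v := [/\ bounded_along u, bounded_along v &
  forall e : K, 0 < e -> \forall w \near F, `|u w - v w| < e].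

Lemma bounded_along_cst c : bounded_along (fun=> c).
Proof.
exists (`|c| + 1); first by rewrite ltr_wpDl.
by apply: nearW => w; rewrite lerDl.
Qed.

Lemma bounded_alongD u v : bounded_along u -> bounded_along v ->
  bounded_along (fun w => u w + v w).
Proof.
move=> [M M0 uM] [N N0 vN]; exists (M + N); first exact: addr_gt0.
by apply: filterS2 uM vN => w uM vN; rewrite (le_trans (ler_normD _ _))// lerD.
Qed.

Lemma bounded_alongM u v : bounded_along u -> bounded_along v ->
  bounded_along (fun w => u w * v w).
Proof.
move=> [M M0 uM] [N N0 vN]; exists (M * N); first exact: mulr_gt0.
by apply: filterS2 uM vN => w uM vN; rewrite normrM ler_pM.
Qed.

Lemma asymptotic_refl u : bounded_along u -> asymptotic u u.
Proof. by move=> bu; split=> // e e0; apply: nearW => w; rewrite subrr normr0. Qed.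

Lemma asymptotic_cst c : asymptotic (fun=> c) (fun=> c).
Proof. exact/asymptotic_refl/bounded_along_cst. Qed.

Lemma asymptotic_eq u v u' v' :
  (\forall w \near F, u w = u' w /\ v w = v' w) ->
  asymptotic u v -> asymptotic u' v'.
Proof.
move=> E [[M M0 uM] [N N0 vN] uv]; split.
- by exists M => //; apply: filterS2 E uM => w [<-].
- by exists N => //; apply: filterS2 E vN => w [_ <-].
- by move=> e e0; apply: filterS2 E (uv e e0) => w [<- <-].
Qed.

Lemma asymptoticD u v u' v' : asymptotic u v -> asymptotic u' v' ->
  asymptotic (fun w => u w + u' w) (fun w => v w + v' w).
Proof.
move=> [bu bv uv] [bu' bv' uv']; split; [exact: bounded_alongD..|] => e e0.
have e20 : 0 < e / 2 by rewrite divr_gt0.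
apply: filterS2 (uv _ e20) (uv' _ e20) => w h h'.
by rewrite opprD addrACA (le_lt_trans (ler_normD _ _))// [ltRHS]splitr ltrD.
Qed.

Lemma asymptoticM u v u' v' : asymptotic u v -> asymptotic u' v' ->
  asymptotic (fun w => u w * u' w) (fun w => v w * v' w).
Proof.
move=> [bu bv uv] [bu' bv' uv']; split; [exact: bounded_alongM..|] => e e0.
case: bv => M M0 vM; case: bu' => N N0 uN.
have eN : 0 < e / 2 / N by rewrite !divr_gt0.
have eM : 0 < e / 2 / M by rewrite !divr_gt0.
have h1 := uv _ eN; have h2 := uv' _ eM.
near=> w.
have -> : u w * u' w - v w * v' w = (u w - v w) * u' w + v w * (u' w - v' w).
  by ring.
rewrite (le_lt_trans (ler_normD _ _))// [ltRHS]splitr ltr_leD// normrM.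
  apply: (@le_lt_trans _ _ (`|u w - v w| * N)).
    by rewrite ler_wpM2l//; near: w.
  by rewrite -ltr_pdivlMr//; near: w.
apply: (@le_trans _ _ (M * `|u' w - v' w|)).
  by rewrite ler_wpM2r//; near: w.
by rewrite mulrC -ler_pdivlMr// ltW//; near: w.
Unshelve. all: by end_near. Qed.

Lemma asymptoticZ c u v : asymptotic u v ->
  asymptotic (fun w => c * u w) (fun w => c * v w).
Proof. by apply: asymptoticM; exact: asymptotic_cst. Qed.

Lemma asymptoticX n u v : asymptotic u v ->
  asymptotic (fun w => u w ^+ n) (fun w => v w ^+ n).
Proof.
move=> uv; elim: n => [|n IH]; first exact: asymptotic_cst.
by apply: asymptotic_eq (asymptoticM uv IH); apply: nearW => w; split; rewrite exprS.
Qed.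

Lemma asymptoticV m u v : 0 < m -> (\forall w \near F, m <= `|u w|) ->
  (\forall w \near F, m <= `|v w|) -> asymptotic u v ->
  asymptotic (fun w => (u w)^-1) (fun w => (v w)^-1).
Proof.
move=> m0 um vm [_ _ uv].
have bV t : (\forall w \near F, m <= `|t w|) -> bounded_along (fun w => (t w)^-1).
  move=> tm; exists m^-1; first by rewrite invr_gt0.
  apply: filterS tm => w tm.
  by rewrite normfV lef_pV2// posrE (lt_le_trans m0).
split; [exact: bV..|] => e e0.
have em : 0 < e * m ^+ 2 by rewrite mulr_gt0// exprn_gt0.
apply: filterS3 um vm (uv _ em) => w um vm h.
have u0 : u w != 0 by rewrite -normr_gt0 (lt_le_trans m0).
have v0 : v w != 0 by rewrite -normr_gt0 (lt_le_trans m0).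
have -> : (u w)^-1 - (v w)^-1 = (v w - u w) / (u w * v w) by field; apply/andP; split.
rewrite normrM normfV distrC ltr_pdivrMr; last by rewrite normr_gt0 mulf_neq0.
by apply: (lt_le_trans h); rewrite ler_pM2l// expr2 normrM ler_pM// ltW.
Qed.

End Asymptotic.

(** * The two filters: vanishing mesh, and uniform convergence on the parameter interval *)

Section TagFilter.
Variables (R : realType).

(** A point is an interval [s, t] with a tag r in it. The filter expresses a limit for small mesh,
    uniform in the position of the interval and of the tag. *)
Definition tag_filter : set_system (R * R * R) := [set A | exists2 d : R, 0 < d &
  forall s t r, 0 <= s -> s <= r -> r <= t -> t <= 1 -> t - s < d -> A (s, t, r)].

Global Instance tag_filter_filter : Filter tag_filter.
Proof.
split.
- by exists 1.
- move=> P Q [d d0 Pd] [e e0 Qe]; exists (Num.min d e).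
    by rewrite lt_min d0 e0.
  by move=> s t r ? ? ? ?; rewrite lt_min => /andP[? ?]; split; [exact: Pd|exact: Qe].
- move=> P Q PQ [d d0 Pd]; exists d => // s t r *; apply: PQ; exact: Pd.
Qed.

Definition unif_filter : set_system (nat * R) := [set A |
  exists n : nat, forall m t, (n <= m)%N -> 0 <= t <= 1 -> A (m, t)].

Global Instance unif_filter_filter : Filter unif_filter.
Proof.
split.
- by exists 0%N.
- move=> P Q [n Pn] [m Qm]; exists (maxn n m) => k t; rewrite geq_max.
  by move=> /andP[nk mk] t01; split; [exact: Pn|exact: Qm].
- move=> P Q PQ [n Pn]; exists n => m t nm t01; apply: PQ; exact: Pn.
Qed.

End TagFilter.
Arguments tag_filter {R}.
Arguments unif_filter {R}.

(** * Contour integrals *)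

Lemma realC_gt0 (R : realType) (e : R) : (0 < e%:C%C) = (0 < e).
Proof. by rewrite (ltcR 0 e). Qed.

Lemma gt0_realC (R : realType) (e : complex R) : 0 < e ->
  exists2 r : R, 0 < r & e = r%:C%C.
Proof.
move=> e0; have /RRe_real eE := gtr0_real e0.
by exists (complex.Re e); rewrite // -realC_gt0 eE.
Qed.

Section Integral.
Variable R : realType.
Local Notation C := (complex R).
Variable gamma : R -> C^o.
Hypothesis gamma_rect : rectifiable gamma.
Implicit Types (F G : C -> C) (I J c : C).

Lemma is_contour_integral_ext F G I :
  (forall t, 0 <= t <= 1 -> F (gamma t) = G (gamma t)) ->
  is_contour_integral gamma F I -> is_contour_integral gamma G I.
Proof.
move=> FG FI e e0; have [d d0 Fd] := FI e e0; exists d => // p tag pP tagP.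
rewrite (_ : riemann_stieltjes_sum _ _ _ _ = riemann_stieltjes_sum gamma F p tag).
  exact: Fd.
rewrite /riemann_stieltjes_sum !big_mkord; apply: eq_bigr => n _; rewrite FG//.
have [_ /andP[h1 h2]] := tagP n (ltn_ord n).
rewrite (le_trans _ h1) ?(le_trans h2)//.
  by apply: (itv_partition_nth_le _ pP); rewrite ltnS.
by apply: (itv_partition_nth_ge _ pP); rewrite ltnW// ltnS.
Qed.

Lemma is_contour_integralD F G I J : is_contour_integral gamma F I ->
  is_contour_integral gamma G J ->
  is_contour_integral gamma (fun x => F x + G x) (I + J).
Proof.
move=> FI GJ e e0; have e20 : 0 < e / 2 by rewrite divr_gt0.
have [d1 d10 H1] := FI _ e20; have [d2 d20 H2] := GJ _ e20.
exists (Num.min d1 d2); first by rewrite lt_min d10.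
move=> p tag pP tagP.
have -> : riemann_stieltjes_sum gamma (fun x => F x + G x) p tag =
    riemann_stieltjes_sum gamma F p tag + riemann_stieltjes_sum gamma G p tag.
  by rewrite /riemann_stieltjes_sum -big_split; apply: eq_bigr => n _; rewrite mulrDl.
rewrite opprD addrACA (le_lt_trans (ler_normD _ _))//.
rewrite (splitr e) rmorphD/= ltrD//; [apply: H1|apply: H2] => // n /tagP[].
  by rewrite lt_min => /andP[].
by rewrite lt_min => /andP[].
Qed.

Lemma is_contour_integralZ c F I : is_contour_integral gamma F I ->
  is_contour_integral gamma (fun x => c * F x) (c * I).
Proof.
(* The 1 added to [|c|] keeps the divisor positive when c = 0. *)
move=> FI e e0; have [r r0 rE] : exists2 r : R, 0 < r & `|c| + 1 = r%:C%C.
  by apply: gt0_realC; rewrite ltr_wpDl.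
have er : 0 < e / r by rewrite divr_gt0.
have [d d0 H] := FI _ er; exists d => // p tag pP tagP.
have -> : riemann_stieltjes_sum gamma (fun x => c * F x) p tag =
    c * riemann_stieltjes_sum gamma F p tag.
  by rewrite /riemann_stieltjes_sum mulr_sumr; apply: eq_bigr => n _; rewrite mulrA.
rewrite -mulrBr normrM; have := H p tag pP tagP.
move: (riemann_stieltjes_sum _ _ _ _ - _) => z zr.
apply: (@le_lt_trans _ _ (r%:C%C * `|z|)); first by rewrite ler_wpM2r// -rE lerDl.
rewrite mulrC -ltr_pdivlMr ?realC_gt0//; apply: (lt_le_trans zr).
by rewrite -(fmorph_div (real_complex R)).
Qed.

Lemma itv_partition_subdiv (p : seq R) (tag : nat -> R) (d : R) :
  itv_partition 0 1 p ->
  (forall n, (n < size p)%N -> subdiv p n.+1 - subdiv p n < d /\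
     subdiv p n <= tag n <= subdiv p n.+1) ->
  forall n, (n < size p)%N -> [/\ 0 <= subdiv p n, subdiv p n <= tag n,
    tag n <= subdiv p n.+1, subdiv p n.+1 <= 1 & subdiv p n.+1 - subdiv p n < d].
Proof.
move=> pP tagP n np; have [h /andP[h1 h2]] := tagP n np; split => //.
  by apply: (itv_partition_nth_ge _ pP); rewrite ltnW// ltnS.
by apply: (itv_partition_nth_le _ pP); rewrite ltnS.
Qed.

(** The length estimate, for arbitrary terms [f n]: it is applied to the difference of two Riemann
    sums and to that of a Riemann sum and a telescoping sum. *)
Lemma riemann_stieltjes_small : exists2 L : R, 0 < L &
  forall (p : seq R) (f : nat -> C) (e : C), itv_partition 0 1 p -> 0 <= e ->
    (forall n, (n < size p)%N ->
       `|f n| <= e * `|gamma (subdiv p n.+1) - gamma (subdiv p n)|) ->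
    `|\sum_(0 <= n < size p) f n| <= e * L%:C%C.
Proof.
have [L LP] := gamma_rect; exists (`|L| + 1); first by rewrite ltr_wpDl.
move=> p f e pP e0 fe; apply: (le_trans (ler_norm_sum _ _ _)).
apply: (@le_trans _ _ (e * \sum_(0 <= n < size p)
    `|gamma (subdiv p n.+1) - gamma (subdiv p n)|)).
  rewrite mulr_sumr !big_mkord; apply: ler_sum => n _; exact: fe.
rewrite ler_wpM2l// (le_trans (LP p pP))// lecR.
by rewrite (le_trans (ler_norm _))// lerDl.
Qed.

Lemma is_contour_integral_unif (F_ : nat -> C -> C) F I :
  (forall e : C, 0 < e -> \forall w \near unif_filter,
     `|F_ w.1 (gamma w.2) - F (gamma w.2)| < e) ->
  (forall n, is_contour_integral gamma (F_ n) I) ->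
  is_contour_integral gamma F I.
Proof.
move=> FF FI e e0; have [L L0 LP] := riemann_stieltjes_small.
have eL : 0 < (e / 4 / L)%:C%C :> C by rewrite realC_gt0 !divr_gt0.
have [N NP] := FF _ eL.
have e20 : 0 < e / 2 by rewrite divr_gt0.
have [d d0 dP] := FI N _ e20; exists d => // p tag pP tagP.
have := dP p tag pP tagP; set S := riemann_stieltjes_sum _ _ _ _ => SI.
have SP := itv_partition_subdiv pP tagP.
set T := riemann_stieltjes_sum _ _ _ _.
have TS : `|T - S| <= (e / 4)%:C%C.
  have -> : (e / 4)%:C%C = (e / 4 / L)%:C%C * L%:C%C :> C.
    by rewrite -rmorphM/= divfK// gt_eqF.
  rewrite /T /S /riemann_stieltjes_sum -sumrB; apply: LP => //; first exact: ltW.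
  move=> n np; rewrite -mulrBl normrM ler_wpM2r// distrC ltW//.
  have [h1 h2 h3 h4 _] := SP n np.
  have := NP N (tag n) (leqnn _); apply.
  by rewrite (le_trans h1 h2) (le_trans h3 h4).
rewrite -(subrK S T) -addrA (le_lt_trans (ler_normD _ _))//.
apply: (@lt_le_trans _ _ ((e / 4)%:C%C + (e / 2)%:C%C)); first exact: ler_ltD.
by rewrite -rmorphD lecR; lra.
Qed.

(* D is the difference quotient of G along the curve. *)
Definition primitive_along G F := exists2 D : R * R -> C,
  forall s t, 0 <= s <= 1 -> 0 <= t <= 1 ->
    G (gamma t) - G (gamma s) = D (s, t) * (gamma t - gamma s) &
  [/\ asymptotic tag_filter (fun w => D w.1) (fun w => F (gamma w.2)),
      asymptotic tag_filter (fun w => G (gamma w.1.1)) (fun w => G (gamma w.2))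
    & asymptotic tag_filter (fun w => G (gamma w.1.2)) (fun w => G (gamma w.2))].

Lemma is_contour_integral_primitive G F : gamma 0 = gamma 1 ->
  primitive_along G F -> is_contour_integral gamma F 0.
Proof.
move=> gamma01 [D DP [[_ _ DF] _ _]] e e0.
have [L L0 LP] := riemann_stieltjes_small.
have eL : 0 < (e / 2 / L)%:C%C :> C by rewrite realC_gt0 !divr_gt0.
have [d d0 dP] := DF _ eL; exists d => // p tag pP tagP.
have SP := itv_partition_subdiv pP tagP.
rewrite subr0; set T := riemann_stieltjes_sum _ _ _ _.
(* The Riemann sum is compared termwise with this telescoping sum, which is 0 because the curve is
   closed. Each difference is F(tag) - D times an increment of [gamma]. *)
have S0 : \sum_(0 <= n < size p) (G (gamma (subdiv p n.+1)) - G (gamma (subdiv p n))) = 0.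
  rewrite telescope_sumr//.
  by rewrite /subdiv (itv_partition_nth_size _ pP) /= gamma01 subrr.
rewrite -[T]subr0 -S0 /T /riemann_stieltjes_sum -sumrB.
apply: (@le_lt_trans _ _ ((e / 2 / L)%:C%C * L%:C%C)); last first.
  by rewrite -rmorphM/= divfK ?gt_eqF// ltcR; lra.
apply: LP => //; first exact: ltW.
move=> n np; have [h1 h2 h3 h4 h5] := SP n np.
rewrite DP; last 2 first.
- by rewrite h1 (le_trans h2)// (le_trans h3).
- by rewrite h4 (le_trans h1)// (le_trans h2).
rewrite -mulrBl normrM ler_wpM2r// distrC ltW//.
exact: (dP _ _ _ h1 h2 h3 h4 h5).
Qed.

(** The difference quotient of the product is D1 G2(s) + G1(t) D2. Moving G2(s) and G1(t) to the tag
    is the purpose of the last two clauses of [primitive_along]. *)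
Lemma primitive_alongM G1 F1 G2 F2 :
  primitive_along G1 F1 -> primitive_along G2 F2 ->
  primitive_along (fun x => G1 x * G2 x) (fun x => F1 x * G2 x + G1 x * F2 x).
Proof.
move=> [D1 D1P [DF1 s1 t1]] [D2 D2P [DF2 s2 t2]].
exists (fun w => D1 w * G2 (gamma w.1) + G1 (gamma w.2) * D2 w).
  move=> s t s01 t01 /=.
  have -> : G1 (gamma t) * G2 (gamma t) - G1 (gamma s) * G2 (gamma s) =
    (G1 (gamma t) - G1 (gamma s)) * G2 (gamma s) +
      G1 (gamma t) * (G2 (gamma t) - G2 (gamma s)) by ring.
  by rewrite D1P// D2P//; ring.
by split; [apply: asymptoticD; exact: asymptoticM|exact: asymptoticM..].
Qed.

Lemma primitive_along_exp n G F : primitive_along G F ->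
  primitive_along (fun x => G x ^+ n.+1) (fun x => n.+1%:R * (G x ^+ n * F x)).
Proof.
move=> GF; elim: n => [|n IH].
  by under eq_fun do rewrite expr1; under [X in primitive_along _ X]eq_fun do rewrite expr0 !mul1r.
have := primitive_alongM IH GF.
congr (primitive_along _ _); apply/funext => x; first by rewrite -exprSr.
by rewrite [n.+2%:R]mulrS !exprS; ring.
Qed.

Lemma primitive_along_affine c d G F : primitive_along G F ->
  primitive_along (fun x => c * G x + d) (fun x => c * F x).
Proof.
move=> [D DP [DF s t]]; exists (fun w => c * D w).
  by move=> ? ? ? ?; rewrite -mulrA -DP//; ring.
split; first exact: asymptoticZ.
- by apply: asymptoticD; [exact: asymptoticZ|exact: asymptotic_cst].
- by apply: asymptoticD; [exact: asymptoticZ|exact: asymptotic_cst].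
Qed.

End Integral.

(** * Compactness of the curve and the basic primitives *)

Section Curve.
Variable R : realType.
Local Notation C := (complex R).
Variable gamma : R -> C^o.
Hypothesis gamma_cont : {within `[0, 1], continuous gamma}.

Lemma curve_continuous (e : C) (t : R) : 0 < e -> 0 <= t <= 1 -> exists2 d : R, 0 < d &
  forall s, 0 <= s <= 1 -> `|t - s| < d -> `|gamma t - gamma s| < e.
Proof.
move=> e0 t01.
have /subspace_continuousP /(_ t) := gamma_cont.
have tI : [set` `[0, 1]%R] t by rewrite /= in_itv.
move=> /(_ tI) /cvgrPdist_lt /(_ e e0).
rewrite near_withinE => /nbhs_ballP[d /= d0 dP]; exists d => // s s01 ts.
by apply: dP; rewrite //= in_itv.
Qed.

Lemma curve_unif_continuous (e : C) : 0 < e -> exists2 d : R, 0 < d &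
  forall s t, 0 <= s <= 1 -> 0 <= t <= 1 -> `|s - t| < d -> `|gamma s - gamma t| < e.
Proof.
move=> e0; have e20 : 0 < e / 2 by rewrite divr_gt0.
(* A modulus d at s yields d/2 at every u within d/2 of s, since t is then still within d of s;
   compactness makes the radius uniform. *)
have := (compact_near_coveringP _).1 (@segment_compact R 0 1).
move=> /(_ R 0^'+ (fun d s => 0 <= s <= 1 -> forall t, 0 <= t <= 1 ->
  `|s - t| < d -> `|gamma s - gamma t| < e)) /(_ _).
case.
- move=> s; rewrite /= in_itv/= => s01.
  have [d d0 dP] := curve_continuous e20 s01.
  have d20 : 0 < d / 2 by rewrite divr_gt0.
  exists (ball s (d / 2), [set r | r < d / 2]); first split => //=.
  + exact: nbhsx_ballx.
  + exact: nbhs_right_lt.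
  + move=> [u r] [/= su rd] u01 t t01 ut.
    rewrite -(subrK (gamma s) (gamma u)) -addrA (le_lt_trans (ler_normD _ _))//.
    rewrite [ltRHS]splitr ltrD//.
      rewrite distrC; apply: dP => //; rewrite (lt_le_trans su)//; lra.
    apply: dP => //; rewrite -(subrK u s) -addrA (le_lt_trans (ler_normD _ _))//.
    by rewrite (splitr d) ltrD// (lt_trans ut).
- move=> d /= d0 dP; exists (d / 2); first by rewrite divr_gt0.
  move=> s t s01 t01 st.
  apply: (dP (d / 2) _ _ s) => //=; rewrite ?in_itv//=; last by rewrite divr_gt0.
  by rewrite sub0r normrN gtr0_norm ?divr_gt0//; lra.
Qed.

(** The interval [0, t] is cut into n > 1/d steps, each of which moves the curve by less than 1. *)
Lemma curve_bounded : exists2 M : C, 0 < M & forall t, 0 <= t <= 1 -> `|gamma t| <= M.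
Proof.
have [d d0 dP] := curve_unif_continuous (@ltr01 C).
have [n nP] : exists n : nat, d^-1 < n%:R.
  by exists (Num.bound d^-1); rewrite archi_boundP// invr_ge0 ltW.
have n0 : 0 < n%:R :> R by rewrite (lt_trans _ nP)// invr_gt0.
exists (`|gamma 0| + n%:R + 1); first by rewrite ltr_wpDl// addr_ge0.
move=> t /andP[t0 t1].
have step k : (k <= n)%N -> `|gamma (t * (k%:R / n%:R))| <= `|gamma 0| + k%:R.
  elim: k => [_|k IH kn]; first by rewrite mul0r mulr0 addr0.
  rewrite -(subrK (gamma (t * (k%:R / n%:R))) (gamma (t * (k.+1%:R / n%:R)))).
  have -> : `|gamma 0| + k.+1%:R = (`|gamma 0| + k%:R) + 1 :> C.
    by rewrite -addrA natr1.
  rewrite (le_trans (ler_normD _ _))// addrC lerD//.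
    by rewrite IH// ltnW.
  have I j : (j <= n)%N -> 0 <= t * (j%:R / n%:R) <= 1.
    move=> jn; rewrite mulr_ge0 ?divr_ge0//= mulr_ile1 ?divr_ge0//.
    by rewrite ler_pdivrMr// mul1r ler_nat.
  rewrite ltW// dP ?I//; first exact: ltnW.
  have -> : t * (k.+1%:R / n%:R) - t * (k%:R / n%:R) = t / n%:R.
    by rewrite -natr1; field; rewrite gt_eqF.
  rewrite ger0_norm ?divr_ge0// (le_lt_trans (ler_wpM2r _ t1)) ?invr_ge0//.
  by rewrite mul1r -[ltRHS]invrK ltf_pV2 ?posrE ?invr_gt0.
have := step n (leqnn n); rewrite divff ?gt_eqF// mulr1 => /le_trans; apply.
by rewrite lerDl.
Qed.

Lemma curve_away w : ~ curve_image gamma w ->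
  exists2 m : R, 0 < m & forall t, 0 <= t <= 1 -> m%:C%C <= `|gamma t - w|.
Proof.
move=> wP.
have := (compact_near_coveringP _).1 (@segment_compact R 0 1).
move=> /(_ R 0^'+ (fun d s => 0 <= s <= 1 -> d%:C%C <= `|gamma s - w|)) /(_ _).
case.
- move=> s; rewrite /= in_itv/= => s01.
  have [r r0 rE] : exists2 r : R, 0 < r & `|gamma s - w| = r%:C%C.
    apply: gt0_realC; rewrite normr_gt0 subr_eq0; apply/eqP => sw.
    by apply: wP; exists s => //=; rewrite in_itv.
  have r20 : 0 < (r / 2)%:C%C :> C by rewrite realC_gt0 divr_gt0.
  have [d d0 dP] := curve_continuous r20 s01.
  exists (ball s d, [set e | e < r / 2]); first split => //=.
  + exact: nbhsx_ballx.
  + by apply: nbhs_right_lt; rewrite divr_gt0.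
  + move=> [u e] [/= su er] u01.
    have /ltW ur : `|gamma s - gamma u| < (r / 2)%:C%C by exact: dP.
    have := ler_distD (gamma u) (gamma s) w; rewrite rE -lerBlDl => h.
    apply: le_trans h; apply: (@le_trans _ _ (r%:C%C - (r / 2)%:C%C)).
      by rewrite -rmorphB lecR; lra.
    by rewrite lerD2l lerN2.
- move=> d /= d0 dP; exists (d / 2); first by rewrite divr_gt0.
  move=> s s01.
  apply: (dP (d / 2) _ _ s) => //=; rewrite ?in_itv//=; last by rewrite divr_gt0.
  by rewrite sub0r normrN gtr0_norm ?divr_gt0//; lra.
Qed.

Lemma asymptotic_curve :
  asymptotic tag_filter (fun w => gamma w.1.1 : C) (fun w => gamma w.2 : C) /\
  asymptotic tag_filter (fun w => gamma w.1.2 : C) (fun w => gamma w.2 : C).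
Proof.
have [M M0 MP] := curve_bounded.
have b f : (forall s t r, 0 <= s -> s <= r -> r <= t -> t <= 1 -> 0 <= f (s, t, r) <= 1) ->
    bounded_along tag_filter (fun w => gamma (f w) : C).
  move=> fP; exists M => //; exists 1 => // s t r h1 h2 h3 h4 _; exact/MP/fP.
have b1 : bounded_along tag_filter (fun w => gamma w.1.1 : C).
  by apply: b => s t r /= *; apply/andP; split; lra.
have b2 : bounded_along tag_filter (fun w => gamma w.1.2 : C).
  by apply: b => s t r /= *; apply/andP; split; lra.
have b3 : bounded_along tag_filter (fun w => gamma w.2 : C).
  by apply: b => s t r /= *; apply/andP; split; lra.
split; split=> // e /curve_unif_continuous[d d0 dP]; exists d => // s t r /= *; apply: dP;
  try (apply/andP; split); try lra.
- by rewrite ler0_norm; lra.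
- by rewrite ger0_norm; lra.
Qed.

Lemma primitive_along_id : primitive_along gamma id (fun=> 1).
Proof.
have [h1 h2] := asymptotic_curve; exists (fun=> 1) => [s t _ _|]; first by rewrite mul1r.
by split=> //; exact: asymptotic_cst.
Qed.

(** The difference quotient of 1/(x - w) between x and y is -1/((x - w)(y - w)), and [curve_away]
    keeps the denominators away from 0. *)
Lemma primitive_along_inv (w : C) : ~ curve_image gamma w ->
  primitive_along gamma (fun x => (x - w)^-1) (fun x => - (x - w)^-2).
Proof.
move=> wP; have [m m0 mP] := curve_away wP; have [h1 h2] := asymptotic_curve.
have mC : 0 < m%:C%C :> C by rewrite realC_gt0.
have g0 t : 0 <= t <= 1 -> gamma t - w != 0.
  by move=> /mP mt; rewrite -normr_gt0 (lt_le_trans _ mt).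
have n1 : \forall x \near tag_filter, m%:C%C <= `|gamma x.1.1 - w|.
  by exists 1 => // s t r *; apply: mP; apply/andP; split=> /=; lra.
have n2 : \forall x \near tag_filter, m%:C%C <= `|gamma x.1.2 - w|.
  by exists 1 => // s t r *; apply: mP; apply/andP; split=> /=; lra.
have n3 : \forall x \near tag_filter, m%:C%C <= `|gamma x.2 - w|.
  by exists 1 => // s t r *; apply: mP; apply/andP; split=> /=; lra.
have k1 : asymptotic tag_filter (fun x => (gamma x.1.1 - w)^-1 : C)
    (fun x => (gamma x.2 - w)^-1 : C).
  apply: asymptoticV mC n1 n3 _.
  by apply: asymptoticD => //; exact: asymptotic_cst.
have k2 : asymptotic tag_filter (fun x => (gamma x.1.2 - w)^-1 : C)
    (fun x => (gamma x.2 - w)^-1 : C).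
  apply: asymptoticV mC n2 n3 _.
  by apply: asymptoticD => //; exact: asymptotic_cst.
exists (fun x => -1 * ((gamma x.1 - w)^-1 * (gamma x.2 - w)^-1)).
  move=> s t s01 t01 /=; have := g0 _ s01; have := g0 _ t01.
  by move: (gamma s) (gamma t) => x y ? ?; field; apply/andP; split.
split=> //; apply: asymptotic_eq (asymptoticZ (-1) (asymptoticM k1 k2)).
by apply: nearW => x; split=> //; rewrite mulN1r -expr2 exprVn.
Qed.

End Curve.

(** * Winding numbers *)

Section Winding.
Variable R : realType.
Local Notation C := (complex R).
Variable gamma : R -> C^o.
Hypothesis gammaJ : jordan_curve gamma.
Implicit Types (F G u : C -> C) (I w : C).

Let gamma_cont : {within `[0, 1], continuous gamma}. Proof. by case: gammaJ. Qed.
Let gamma_rect : rectifiable gamma. Proof. by case: gammaJ. Qed.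
Let gamma_closed : gamma 0 = gamma 1. Proof. by case: gammaJ. Qed.

(** A relation rather than a value of [winding_number]: it also asserts that the integral exists,
    whereas [contour_integral] defaults to 0. *)
Definition winds (w c : C) := ~ curve_image gamma w /\
  is_contour_integral gamma (fun x => (x - w)^-1) (c * two_pi_i R).

Lemma is_contour_integral0 G F : primitive_along gamma G F ->
  is_contour_integral gamma F 0.
Proof. exact: is_contour_integral_primitive. Qed.

Lemma is_contour_integral_exp n : is_contour_integral gamma (fun x => x ^+ n) 0.
Proof.
have /is_contour_integral0/(is_contour_integralZ n.+1%:R^-1) :=
  primitive_along_exp n (primitive_along_id gamma_cont).
rewrite mulr0; apply: is_contour_integral_ext => // t _.
by rewrite mulr1 mulKf// pnatr_eq0.
Qed.

Lemma is_contour_integral_pole w n : ~ curve_image gamma w ->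
  is_contour_integral gamma (fun x => (x - w) ^- n.+2) 0.
Proof.
move=> wP.
have /is_contour_integral0/(is_contour_integralZ (- n.+1%:R^-1)) :=
  primitive_along_exp n (primitive_along_inv gamma_cont wP).
rewrite mulr0; apply: is_contour_integral_ext => // t _.
rewrite !mulrN mulNr opprK mulKf ?pnatr_eq0//.
by rewrite -!exprVn -exprD addn2.
Qed.

(** F = G/(1 - u) is the sum of the G u^k. The partial sum up to n equals F (1 - u^(n+1)), hence is
    within B/2^(n+1) of F on the curve, and only its first term contributes to the integral. *)
Lemma is_contour_integral_geometric G u F I (B : C) : 0 < B ->
  (forall t, 0 <= t <= 1 -> [/\ `|u (gamma t)| <= 2^-1, `|F (gamma t)| <= B &
     F (gamma t) * (1 - u (gamma t)) = G (gamma t)]) ->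
  is_contour_integral gamma G I ->
  (forall n, is_contour_integral gamma (fun x => G x * u x ^+ n.+1) 0) ->
  is_contour_integral gamma F I.
Proof.
move=> B0 uFG GI GuI.
pose F_ n := fun x => \sum_(k < n.+1) G x * u x ^+ k.
apply: (@is_contour_integral_unif _ _ gamma_rect F_) => [e e0|n]; last first.
  elim: n => [|n IH].
    by apply: is_contour_integral_ext GI => // t _; rewrite /F_ big_ord1 mulr1.
  rewrite -[I]addr0; apply: is_contour_integral_ext (is_contour_integralD IH (GuI n)) => // t _.
  by rewrite /F_ [RHS]big_ord_recr.
have [r r0 rE] : exists2 r : R, 0 < r & e / B = r%:C%C.
  by apply: gt0_realC; rewrite divr_gt0.
exists (Num.bound r^-1) => n t nP t01 /=.
have [u2 FB FuG] := uFG _ t01.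
rewrite /F_ -mulr_sumr -FuG -mulrA.
have -> : (1 - u (gamma t)) * (\sum_(k < n.+1) u (gamma t) ^+ k) = 1 - u (gamma t) ^+ n.+1.
  by rewrite -opprB mulNr -subrX1 opprB.
rewrite mulrBr mulr1 addrAC subrr sub0r normrN normrM.
rewrite (le_lt_trans (ler_wpM2r _ FB))// mulrC -ltr_pdivlMr// rE.
rewrite normrX (@le_lt_trans _ _ (2^-1 ^+ n.+1))//; first by rewrite lerXn2r ?nnegrE.
rewrite (_ : 2^-1 ^+ n.+1 = (2^-1 ^+ n.+1)%:C%C); last first.
  by rewrite rmorphXn/= fmorphV rmorph_nat.
rewrite ltcR exprVn -[ltRHS]invrK ltf_pV2 ?posrE ?invr_gt0 ?exprn_gt0//.
rewrite (@lt_le_trans _ _ (Num.bound r^-1)%:R)//.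
  by rewrite archi_boundP// invr_ge0 ltW.
have : (Num.bound r^-1 <= 2 ^ n.+1)%N.
  exact: leq_trans nP (ltnW (ltnW (ltn_expl _ _))).
by rewrite -(ler_nat R) natrX.
Qed.

(* 1 / (x - w') expands in a geometric series around w; all its terms but the first
   have a primitive. *)
Lemma winds_near w w' c (m : R) : 0 < m ->
  (forall t, 0 <= t <= 1 -> m%:C%C <= `|gamma t - w|) ->
  `|w' - w| <= (m / 2)%:C%C -> winds w c -> winds w' c.
Proof.
move=> m0 mP ww' [wP wI].
have mC : 0 < (m / 2)%:C%C :> C by rewrite realC_gt0 divr_gt0.
have h t : 0 <= t <= 1 -> (m / 2)%:C%C <= `|gamma t - w'|.
  move=> t01; have := ler_distD w' (gamma t) w; rewrite -lerBlDr => hd; apply: le_trans hd.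
  apply: (@le_trans _ _ (m%:C%C - (m / 2)%:C%C)); last exact: lerB (mP _ t01) ww'.
  by rewrite -rmorphB lecR; lra.
split.
  move=> [t]; rewrite /= in_itv/= => /h + tw'.
  by rewrite tw' subrr normr0 lt_geF.
apply: (@is_contour_integral_geometric (fun x => (x - w)^-1)
  (fun x => (w' - w) * (x - w)^-1) _ _ ((m / 2)%:C%C)^-1) => //.
- by rewrite invr_gt0.
- move=> t t01; have h1 := mP _ t01; have h2 := h _ t01.
  have w0 : 0 < `|gamma t - w| by rewrite (lt_le_trans _ h1)// realC_gt0.
  have w'0 : 0 < `|gamma t - w'| by rewrite (lt_le_trans _ h2).
  split.
  + rewrite normrM normfV ler_pdivrMr// (le_trans ww')//.
    rewrite (_ : (m / 2)%:C%C = 2^-1 * m%:C%C :> C) ?ler_wpM2l ?invr_ge0//.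
    by rewrite rmorphM/= fmorphV rmorph_nat mulrC.
  + by rewrite normfV lef_pV2 ?posrE.
  + move: w0 w'0; rewrite !normr_gt0 => w0 w'0; field.
    by rewrite w0.
- move=> n; have := is_contour_integralZ ((w' - w) ^+ n.+1) (is_contour_integral_pole n wP).
  rewrite mulr0; apply: is_contour_integral_ext => // t _.
  by rewrite exprMn mulrCA -exprS exprVn.
Qed.

(** Here 1/(x - w) is expanded in powers of x/w, and every monomial has integral 0. *)
Lemma winds_far w (M : C) : 0 < M -> (forall t, 0 <= t <= 1 -> `|gamma t| <= M) ->
  2 * M <= `|w| -> winds w 0.
Proof.
move=> M0 MP wM.
have h t : 0 <= t <= 1 -> M <= `|gamma t - w|.
  move=> /MP tM; rewrite distrC (le_trans _ (lerB_dist _ _))//.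
  by rewrite (le_trans _ (lerB wM tM))// mulr_natl mulr2n addrK.
have w0 : 0 < `|w| by rewrite (lt_le_trans _ wM)// mulr_gt0.
have w0' : w != 0 by rewrite -normr_gt0.
split.
  move=> [t]; rewrite /= in_itv/= => /h + tw'.
  by rewrite tw' subrr normr0 lt_geF.
rewrite mul0r; apply: (@is_contour_integral_geometric (fun x => - w^-1)
  (fun x => x * w^-1) _ _ M^-1) => //.
- by rewrite invr_gt0.
- move=> t t01; have h1 := h _ t01; have h2 := MP _ t01.
  have tw : 0 < `|gamma t - w| by rewrite (lt_le_trans _ h1).
  split.
  + rewrite normrM normfV ler_pdivrMr// (le_trans h2)//.
    by rewrite mulrC ler_pdivlMr// mulrC.
  + by rewrite normfV lef_pV2 ?posrE.
  + by move: tw; rewrite normr_gt0 => tw; field; apply/andP; split.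
- have := is_contour_integralZ (- w^-1) (is_contour_integral_exp 0).
  rewrite mulr0; apply: is_contour_integral_ext => // t _.
  by rewrite expr0 mulr1.
- move=> n; have := is_contour_integralZ (- w^-1 * w^-1 ^+ n.+1) (is_contour_integral_exp n.+1).
  rewrite mulr0; apply: is_contour_integral_ext => // t _.
  by rewrite exprMn; ring.
Qed.

(** The boolean covers the condition and its negation, both of which must be open for the clopen
    argument. *)
Lemma open_winds c (b : bool) :
  open [set w : C^o | ~ curve_image gamma w /\ (if b then winds w c else ~ winds w c)].
Proof.
rewrite openE => w [wP wb].
have [m m0 mP] := curve_away gamma_cont wP.
(* With radius m/4, w' stays at distance at least m/2 from the curve, so that [winds_near] also
   leads from w' back to w, as the negated case requires. *)
apply/nbhs_ballP; exists (m / 4)%:C%C; first by rewrite /= realC_gt0 divr_gt0.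
move=> w' /= ww'.
have {}ww' : `|w - w'| <= (m / 4)%:C%C by exact: ltW.
have h t : 0 <= t <= 1 -> (m / 2)%:C%C <= `|gamma t - w'|.
  move=> t01; have := ler_distD w' (gamma t) w; rewrite -lerBlDr => hd; apply: le_trans hd.
  apply: (@le_trans _ _ (m%:C%C - (m / 4)%:C%C)); last first.
    by apply: lerB (mP _ t01) _; rewrite distrC.
  by rewrite -rmorphB lecR; lra.
have w'P : ~ curve_image gamma w'.
  move=> [t]; rewrite /= in_itv/= => /h + tw'.
  by rewrite tw' subrr normr0 lt_geF// realC_gt0 divr_gt0.
split=> //; case: b wb => wb.
  apply: (winds_near m0 mP _ wb); rewrite distrC (le_trans ww')// lecR; lra.
move=> ww; apply: wb; apply: (winds_near _ h _ ww); first by rewrite divr_gt0.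
rewrite (le_trans ww')// lecR; lra.
Qed.

(* Winding number 0 is a relatively clopen condition on the component of w, and it
   holds far away from the curve. *)
Lemma winds_exterior w : jordan_exterior gamma w -> winds w 0.
Proof.
move=> [wP Ew]; set E := connected_component _ (w : C^o) in Ew.
have [M M0 MP] := curve_bounded gamma_cont.
have [v Ev vM] : exists2 v, E v & 2 * M <= `|v : C|.
  apply: contrapT => noE; apply: Ew; exists (2 * M); split.
    by rewrite realM// ?realn// gtr0_real.
  move=> N MN x Ex /=; have [//|xN] := real_leP (normr_real (x : C)) (gtr0_real (lt_trans (mulr_gt0 (ltr0n _ 2) M0) MN) : N \is Num.real).
  by case: noE; exists x => //; rewrite ltW// (lt_trans MN).
suff EE : [set x | E x /\ winds x 0] = E.
  have [] // : [set x | E x /\ winds x 0] w.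
  by rewrite EE; exact: connected_component_refl.
have ES x : E x -> ~ curve_image gamma x by move=> /connected_component_sub.
apply: (component_connected (A := ~` curve_image gamma) (x := (w : C^o))).
- by exists v; split=> //; exact: winds_far M0 MP vM.
- exists [set x : C^o | ~ curve_image gamma x /\ winds x 0]; first exact: (@open_winds 0 true).
  by apply/seteqP; split=> x /= [Ex]; [have := ES _ Ex|case].
- exists (~` [set x : C^o | ~ curve_image gamma x /\ ~ winds x 0]).
    exact/open_closedC/(@open_winds 0 false).
  apply/seteqP; split=> x /= [Ex h]; split=> //; first by case.
  by apply: contrapT => nw; apply: h; split => //; exact: ES.
Qed.

(* The value 1 differs from the default value 0 of [contour_integral], so that
   [counterclockwise] also provides the existence of the integral. *)
Lemma winds_interior w : counterclockwise gamma -> jordan_interior gamma w ->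
  winds w 1.
Proof.
move=> cc wi; have h := cc w wi; case: wi => wP _; split=> //; rewrite mul1r.
move: h; rewrite /winding_number /contour_integral.
case: xgetP => [I _ II w1|_ /eqP]; last by rewrite mulr0 eq_sym oner_eq0.
suff -> : two_pi_i R = I by [].
have : (two_pi_i R)^-1 != 0 by apply/eqP => e; move: w1; rewrite e mul0r => /eqP; rewrite eq_sym oner_eq0.
by rewrite invr_eq0 => p0; rewrite -[RHS](mulVKf p0) w1 mulr1.
Qed.

End Winding.

(** * Partial fractions *)

Section PartialFractions.
Variable R : realType.
Local Notation C := (complex R).
Implicit Types (G H : C -> C) (P : C -> Prop).

(** The span of the monomials and of the polar parts at points of [P]. [pfrac_ext] disregards 0 and
    the points of [P], where division has default values that would break the partial fraction
    identities. *)
Inductive pfrac P : (C -> C) -> Prop :=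
| pfrac_exp (n : int) : pfrac P (fun x => x ^ n)
| pfrac_pole r m of P r : pfrac P (fun x => (x - r) ^- m.+1)
| pfrac_lin c G H of pfrac P G & pfrac P H : pfrac P (fun x => c * G x + H x)
| pfrac_ext G H of (forall x, x != 0 -> ~ P x -> G x = H x) & pfrac P G : pfrac P H.

Variable P : C -> Prop.
Hypothesis P0 : forall r, P r -> r != 0.

Lemma pfracD G H : pfrac P G -> pfrac P H -> pfrac P (fun x => G x + H x).
Proof.
move=> pG pH; apply: pfrac_ext (pfrac_lin 1 pG pH) => x _ _.
by rewrite mul1r.
Qed.

Lemma pfrac0 : pfrac P (fun=> 0).
Proof.
by apply: pfrac_ext (pfrac_lin (-1) (pfrac_exp P 0) (pfrac_exp P 0)) => x _ _; ring.
Qed.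

Lemma pfracZ c G : pfrac P G -> pfrac P (fun x => c * G x).
Proof.
by move=> pG; apply: pfrac_ext (pfrac_lin c pG pfrac0) => x _ _; rewrite addr0.
Qed.

Lemma pfrac_mulX G : pfrac P G -> pfrac P (fun x => x * G x).
Proof.
elim=> {G} [n|r m Pr|c G H _ pG _ pH|G H GH _ pG].
- by apply: pfrac_ext (pfrac_exp P (1 + n)) => x x0 _; rewrite expfzDr.
- have pm : pfrac P (fun x => (x - r) ^- m).
    case: m => [|m]; last exact: pfrac_pole.
    by apply: pfrac_ext (pfrac_exp P 0) => x _ _; rewrite expr0 invr1.
  apply: pfrac_ext (pfracD pm (pfracZ r (pfrac_pole m Pr))) => x _ Px.
  have xr : x - r != 0 by rewrite subr_eq0; apply/eqP => xr; apply: Px; rewrite xr.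
  by rewrite exprS; have := expf_neq0 m xr; move: (_ ^+ m) => y y0; field; rewrite xr y0.
- by apply: pfrac_ext (pfrac_lin c pG pH) => x _ _; ring.
- by apply: pfrac_ext pG => x x0 Px; rewrite GH.
Qed.

Lemma pfrac_mulV G : pfrac P G -> pfrac P (fun x => x^-1 * G x).
Proof.
elim=> {G} [n|r m Pr|c G H _ pG _ pH|G H GH _ pG].
- by apply: pfrac_ext (pfrac_exp P (-1 + n)) => x x0 _; rewrite expfzDr.
- have pm k : pfrac P (fun x => x^-1 * (x - r) ^- k).
    elim: k => [|k IH].
      by apply: pfrac_ext (pfrac_exp P (-1)) => x _ _; rewrite expr0 invr1 mulr1.
    (* Divide x - (x - r) = r by x (x - r)^(k+1). *)
    apply: pfrac_ext (pfracZ r^-1 (pfrac_lin (-1) IH (pfrac_pole k Pr))) => x x0 Px.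
    have xr : x - r != 0 by rewrite subr_eq0; apply/eqP => xr; apply: Px; rewrite xr.
    have r0 := P0 Pr.
    by rewrite exprS; have := expf_neq0 k xr; move: (_ ^+ k) => y y0; field; rewrite r0 xr x0 y0.
  exact: pm.
- by apply: pfrac_ext (pfrac_lin c pG pH) => x _ _; ring.
- by apply: pfrac_ext pG => x x0 Px; rewrite GH.
Qed.

Lemma pfrac_mulXz (n : int) G : pfrac P G -> pfrac P (fun x => x ^ n * G x).
Proof.
move=> pG; case: n => n.
  elim: n => [|n IH]; first by apply: pfrac_ext pG => x _ _; rewrite mul1r.
  by apply: pfrac_ext (pfrac_mulX IH) => x _ _; rewrite mulrA -exprS.
elim: n => [|n IH]; first by apply: pfrac_ext (pfrac_mulV pG).
by apply: pfrac_ext (pfrac_mulV IH) => x x0 _; rewrite mulrA !NegzE -!exprnN [in RHS]exprS invfM.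
Qed.

Lemma pfrac_mul_pole r G : P r -> pfrac P G -> pfrac P (fun x => (x - r)^-1 * G x).
Proof.
move=> Pr; have p1 : pfrac P (fun x => (x - r)^-1).
  by apply: pfrac_ext (pfrac_pole 0 Pr) => x _ _; rewrite expr1.
elim=> {G} [n|s m Ps|c G H _ pG _ pH|G H GH _ pG].
- by apply: pfrac_ext (pfrac_mulXz n p1) => x _ _; rewrite mulrC.
- have [<-|sr] := eqVneq r s.
    by apply: pfrac_ext (pfrac_pole m.+1 Pr) => x _ _; rewrite -invfM -exprS.
  have pm k : pfrac P (fun x => (x - r)^-1 * (x - s) ^- k).
    elim: k => [|k IH].
      by apply: pfrac_ext p1 => x _ _; rewrite expr0 invr1 mulr1.
    (* Divide (x - r) - (x - s) = s - r by (x - r)(x - s)^(k+1); for s = r the order of the pole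
       just went up. *)
    apply: pfrac_ext (pfracZ (s - r)^-1 (pfrac_lin (-1) IH (pfrac_pole k Ps))) => x x0 Px.
    have xr : x - r != 0 by rewrite subr_eq0; apply/eqP => xr; apply: Px; rewrite xr.
    have xs : x - s != 0 by rewrite subr_eq0; apply/eqP => xs; apply: Px; rewrite xs.
    have rs : s - r != 0 by rewrite subr_eq0 eq_sym.
    rewrite exprS; have := expf_neq0 k xs; move: (_ ^+ k) => y y0; field.
    by rewrite rs xr xs y0.
  exact: pm.
- by apply: pfrac_ext (pfrac_lin c pG pH) => x _ _; ring.
- by apply: pfrac_ext pG => x x0 Px; rewrite GH.
Qed.

Lemma pfrac_mul_ev (h : laurent R) G : pfrac P G -> pfrac P (fun x => ev h x * G x).
Proof.
move=> pG; suff E (s : seq int) :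
    pfrac P (fun x => (\sum_(n <- s) mcoeff n h * x ^ n) * G x) by exact: E.
elim: s => [|n s IH].
  by apply: pfrac_ext pfrac0 => x _ _; rewrite big_nil mul0r.
apply: pfrac_ext (pfracD (pfracZ (mcoeff n h) (pfrac_mulXz n pG)) IH) => x _ _.
by rewrite big_cons mulrDl mulrA.
Qed.

End PartialFractions.

(** * Integrals antisymmetric under x -> p/x *)

Section Symmetry.
Variable R : realType.
Local Notation C := (complex R).
Variable gamma : R -> C^o.
Hypothesis gammaJ : jordan_curve gamma.
Variable p : C.
Hypothesis p0 : p != 0.
Hypothesis winds0 : winds gamma 0 1.
Implicit Types (F G H : C -> C).

Let gamma_cont : {within `[0, 1], continuous gamma}. Proof. by case: gammaJ. Qed.
Let gamma_rect : rectifiable gamma. Proof. by case: gammaJ. Qed.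
Let gamma_closed : gamma 0 = gamma 1. Proof. by case: gammaJ. Qed.

(* Exactly one of r and p / r is enclosed by the curve. *)
Definition sym_pole (r : C) :=
  r != 0 /\ exists c, winds gamma r c /\ winds gamma (p / r) (1 - c).

Let off (w : C) (t : R) : ~ curve_image gamma w -> 0 <= t <= 1 -> gamma t - w != 0 :> C.
Proof.
move=> wP t01; rewrite subr_eq0; apply/eqP => tw; apply: wP; by exists t; rewrite //= in_itv.
Qed.

Let nz (t : R) : 0 <= t <= 1 -> (gamma t : C) != 0.
Proof. by move=> t01; have := off winds0.1 t01; rewrite subr0. Qed.

(** The residue is (-1/r)^(m+1) at 0, encircled once, and its opposite at r, encircled c times. The
    recursion splits 1/((x - r) x) and leaves pure powers of 1/(x - r), which have primitives from
    the second power on. *)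
Lemma is_contour_integral_pole_divx r c m : r != 0 -> winds gamma r c ->
  is_contour_integral gamma (fun x => (x - r) ^- m.+1 / x)
    ((- r^-1) ^+ m.+1 * ((1 - c) * two_pi_i R)).
Proof.
move=> r0 [rP rI]; have [oP oI] := winds0.
have step k I J : is_contour_integral gamma (fun x => (x - r) ^- k.+1) I ->
    is_contour_integral gamma (fun x => (x - r) ^- k / x) J ->
    is_contour_integral gamma (fun x => (x - r) ^- k.+1 / x) (r^-1 * (I + -1 * J)).
  move=> kI kJ.
  have := is_contour_integralZ r^-1 (is_contour_integralD kI (is_contour_integralZ (-1) kJ)).
  apply: is_contour_integral_ext => // t t01.
  have x0 := nz t01; have xr := off rP t01; rewrite exprS.
  have := expf_neq0 k xr; move: (_ ^+ k) => y y0; field.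
  by rewrite r0 xr x0 y0.
elim: m => [|m IH].
  have := step 0%N (c * two_pi_i R) (1 * two_pi_i R).
  rewrite expr1 (_ : _ * (_ * _ + _) = - r^-1 * ((1 - c) * two_pi_i R)); last by ring.
  apply.
    by apply: is_contour_integral_ext rI => // t _; rewrite expr1.
  by apply: is_contour_integral_ext oI => // t _; rewrite subr0 expr0 invr1 mul1r.
have := step m.+1 0 _ (is_contour_integral_pole gammaJ m rP) IH.
rewrite (_ : r^-1 * _ = (- r^-1) ^+ m.+2 * ((1 - c) * two_pi_i R))//.
rewrite [in RHS]exprS; move: (_ ^+ m.+1) => y; ring.
Qed.

(** The value does not depend on m because consecutive integrands differ by t x^m/(x - t)^(m+2), a
    constant multiple of the derivative of (x/(x - t))^(m+1). The base x/(x - t) is affine in 1/(x -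
    t). *)
Lemma is_contour_integral_expMpole t c m : winds gamma t c ->
  is_contour_integral gamma (fun x => x ^+ m * (x - t) ^- m.+1) (c * two_pi_i R).
Proof.
move=> [tP tI]; elim: m => [|m IH].
  by apply: is_contour_integral_ext tI => // x _; rewrite expr0 expr1 mul1r.
have /(is_contour_integral_primitive gamma_rect gamma_closed) :=
  primitive_along_exp m (primitive_along_affine t 1 (primitive_along_inv gamma_cont tP)).
move=> /(is_contour_integralZ (- m.+1%:R^-1)) /(is_contour_integralD IH).
rewrite mulr0 addr0; apply: is_contour_integral_ext => // x x01.
have xt := off tP x01.
have -> : t / (gamma x - t) + 1 = gamma x / (gamma x - t) by field.
have m0 : m.+1%:R != 0 :> C by rewrite pnatr_eq0.
rewrite !exprMn !exprVn !exprS !expr0.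
have := expf_neq0 m xt; move: (_ ^+ m) ((gamma x : C) ^+ m) m0 => y z.
move: (m.+1%:R : C) => k k0 y0.
by field; rewrite xt k0 y0.
Qed.

Lemma pfrac_symmetric G : pfrac sym_pole G ->
  is_contour_integral gamma (fun x => (G x - G (p / x)) / x) 0.
Proof.
elim=> {G} [n|r m [r0 [c [rc prc]]]|c G H _ IG _ IH|G H GH _ IG].
- case: n => [[|n]|n].
  + have := is_contour_integralZ 0 (is_contour_integral_exp gammaJ 0).
    by rewrite mulr0; apply: is_contour_integral_ext => // t _; rewrite !expr0z subrr !mul0r.
  + have := is_contour_integralD (is_contour_integral_exp gammaJ n)
      (is_contour_integralZ (- p ^+ n.+1) (is_contour_integral_pole gammaJ n winds0.1)).
    rewrite mulr0 addr0; apply: is_contour_integral_ext => // t t01.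
    have x0 := nz t01; rewrite subr0 -!exprnP exprMn exprVn !exprS.
    have := expf_neq0 n x0; move: (_ ^+ n) => y y0; field.
    by rewrite x0 y0.
  + have := is_contour_integralD (is_contour_integral_pole gammaJ n winds0.1)
      (is_contour_integralZ (- p ^- n.+1) (is_contour_integral_exp gammaJ n)).
    rewrite mulr0 addr0; apply: is_contour_integral_ext => // t t01.
    have x0 := nz t01; rewrite subr0 !NegzE -!exprnN exprMn exprVn !exprS.
    have := expf_neq0 n x0; have := expf_neq0 n p0.
    by move: (_ ^+ n) (p ^+ n) => y z y0 z0; field; rewrite x0 p0 y0 z0.
- have h1 := is_contour_integral_pole_divx m r0 rc.
  have := is_contour_integralZ (- (- r^-1) ^+ m.+1) (is_contour_integral_expMpole m prc).
  move=> /(is_contour_integralD h1); rewrite mulNr subrr.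
  apply: is_contour_integral_ext => // t t01.
  have x0 := nz t01; have xr := off prc.1 t01.
  (* Reflection turns the pole r into p/r; after division by x the second half is a multiple of
     x^m/(x - p/r)^(m+1). *)
  have E : p / gamma t - r = - r * (gamma t)^-1 * (gamma t - p / r).
    by field; rewrite x0 r0.
  rewrite mulrBl E mulNr; congr (_ - _).
  rewrite !exprMn !exprVn !invfM invrK -[(- r) ^- _]exprVn invrN [(gamma t : C) ^+ m.+1]exprS.
  move: (_ ^+ m.+1) (_ ^- m.+1) ((gamma t : C) ^+ m) => y z x'.
  by field.
- have := is_contour_integralD (is_contour_integralZ c IG) IH.
  rewrite mulr0 addr0; apply: is_contour_integral_ext => // t _; ring.
- apply: is_contour_integral_ext IG => // t t01.
  (* G and H must also agree at p/gamma(t). If this were a pole r, the point gamma(t) would be p/r,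
     which [sym_pole] keeps off the curve. *)
  have x0 := nz t01; have px0 : p / gamma t != 0 by rewrite mulf_neq0 ?invr_eq0.
  have nP x : ~ curve_image gamma x -> gamma t <> x.
    by move=> /off /(_ t01); rewrite subr_eq0 => /eqP.
  rewrite !GH//.
  + move=> [_ [c [_ [+ _]]]] => /nP; apply.
    by rewrite invf_div mulrC divfK.
  + by move=> [_ [c [[/nP + _] _]]]; apply.
Qed.

End Symmetry.

(** * The q-Pochhammer symbol *)

Section QPochhammer.
Variable R : realType.
Local Notation C := (complex R).

Lemma norm_complex_le (z : C) : `|z| <= (`|complex.Re z| + `|complex.Im z|)%:C%C.
Proof.
rewrite {1}[z]complexE (le_trans (ler_normD _ _))// rmorphD/= normrM.
have nR (x : R) : `|x%:C%C| = `|x|%:C%C :> C.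
  by rewrite normc_def/= expr0n/= addr0 sqrtr_sqr.
have -> : `|'i%C| = 1 :> C by rewrite normc_def/= expr0n/= add0r expr1n sqrtr1.
by rewrite !nR mul1r.
Qed.

(** Real and imaginary parts do not increase distances, which reduces the claim to the completeness
    of the reals. *)
Lemma complex_cauchy_cvg (u : nat -> C^o) :
  (forall e : C, 0 < e -> exists n, forall m, (n <= m)%N -> `|u m - u n| < e) ->
  cvgn u.
Proof.
move=> uP.
have P (f : C -> R) : (forall x y : C, `|f x - f y|%:C%C <= `|x - y|) ->
    cvgn (fun n => f (u n) : R^o).
  move=> fP; apply: cauchy_cvg; apply: cauchy_exP => e e0.
  have eC : 0 < e%:C%C :> C by rewrite realC_gt0.
  have [n nP] := uP _ eC; exists (f (u n)); exists n => // m /= nm.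
  by rewrite /ball/= distrC -ltcR; exact: le_lt_trans (fP _ _) (nP m nm).
have /P/cvg_ex[a ua] : forall x y : C, `|complex.Re x - complex.Re y|%:C%C <= `|x - y|.
  by move=> x y; have := normc_ge_Re (x - y); case: x y => ? ? [? ?].
have /P/cvg_ex[b ub] : forall x y : C, `|complex.Im x - complex.Im y|%:C%C <= `|x - y|.
  move=> x y; rewrite normc_def lecR -sqrtr_sqr ler_wsqrtr//.
  by case: x y => ? ? [? ?] /=; rewrite lerDr sqr_ge0.
apply/cvg_ex; exists (Complex a b); apply/cvgrPdist_lt => e /gt0_realC[r r0 ->].
have r2 : 0 < r / 2 by rewrite divr_gt0.
move/cvgrPdist_lt/(_ _ r2): ua => ua; move/cvgrPdist_lt/(_ _ r2): ub => ub.
apply: filterS2 ua ub => n ua ub; apply: (le_lt_trans (norm_complex_le _)).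
rewrite ltcR [ltRHS]splitr; move: ua ub; case: (u n) => x y /= *; exact: ltrD.
Qed.

Variable q : C.
Hypothesis hq : 0 < `|q| < 1.
Implicit Types y : C.

Lemma expr_norm_small (e : C) : 0 < e -> exists n, forall m, (n <= m)%N -> `|q| ^+ m < e.
Proof.
move=> /gt0_realC[r r0 ->]; case/andP: hq => /gt0_realC[s s0 ->].
rewrite (ltcR s 1) => s1.
have /cvg_expr/cvgrPdist_lt/(_ _ r0)[n _ nP] : `|s| < 1 by rewrite gtr0_norm.
exists n => m nm; rewrite -rmorphXn/= ltcR; have := nP m nm.
by rewrite /= sub0r normrN ger0_norm// exprn_ge0// ltW.
Qed.

Definition qpart n y : C := \prod_(j < n) (1 - y * q ^+ j).

Lemma qpartD n k y : qpart (n + k) y = qpart n y * qpart k (y * q ^+ n).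
Proof.
rewrite /qpart big_split_ord; congr (_ * _); apply: eq_bigr => j _.
by rewrite -mulrA -exprD.
Qed.

(** By 1 + x <= exp x, the product is at most the exponential of M times a geometric sum in |q|. *)
Lemma qpart_bounded (M : C) : 0 < M -> exists2 B : C, 0 < B &
  forall y n, `|y| <= M -> `|qpart n y| <= B.
Proof.
move=> /gt0_realC[M' M0 ->]; case/andP: hq => /gt0_realC[s s0 sE].
rewrite sE (ltcR s 1) => s1.
have s1' : 0 < 1 - s by rewrite subr_gt0.
exists (expR (M' * (1 - s)^-1))%:C%C; first by rewrite realC_gt0 expR_gt0.
move=> y n yM.
apply: (@le_trans _ _ (expR (M' * ((1 - s ^+ n) / (1 - s))))%:C%C); last first.
  rewrite lecR ler_expR ler_wpM2l//; first exact: ltW.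
  rewrite ler_pdivrMr// mulVf ?gt_eqF//.
  by rewrite gerBl exprn_ge0// ltW.
elim: n => [|n IH].
  by rewrite /qpart big_ord0 normr1 expr0 subrr mul0r mulr0 expR0.
rewrite /qpart big_ord_recr/= normrM -/(qpart n y).
have -> : M' * ((1 - s ^+ n.+1) / (1 - s)) = M' * ((1 - s ^+ n) / (1 - s)) + M' * s ^+ n.
  by rewrite exprS; field; rewrite gt_eqF.
rewrite expRD rmorphM/= ler_pM//.
apply: (le_trans (ler_normB _ _)); rewrite normr1 normrM normrX sE.
apply: (@le_trans _ _ (1 + M' * s ^+ n)%:C%C); last by rewrite lecR expR_ge1Dx.
by rewrite rmorphD rmorphM rmorphXn/= lerD2l ler_wpM2r// exprn_ge0// ltW// realC_gt0.
Qed.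

(** Each further factor changes the product by at most B |y| |q|^(n+k), a geometric series in k. The
    factor |y| is kept for [qpart_asymptoticV]: there the case n = 0, at a small argument, puts tail
    products close to 1. *)
Lemma qpart_diff (M : C) : 0 < M -> exists2 K : C, 0 < K &
  forall y n k, `|y| <= M -> `|qpart (n + k) y - qpart n y| <= K * `|y| * `|q| ^+ n.
Proof.
move=> M0; have [B B0 BP] := qpart_bounded M0; case/andP: hq => q0 q1.
have q1' : 0 < 1 - `|q| by rewrite subr_gt0.
exists (B / (1 - `|q|)); first by rewrite divr_gt0.
move=> y n k yM.
apply: (@le_trans _ _ (B * `|y| * `|q| ^+ n * ((1 - `|q| ^+ k) / (1 - `|q|)))); last first.
  rewrite [leRHS](_ : _ = B * `|y| * `|q| ^+ n * (1 - `|q|)^-1); last by ring.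
  have B0' := ltW B0; rewrite ler_wpM2l ?mulr_ge0 ?exprn_ge0//.
  by rewrite ler_pdivrMr// mulVf ?gt_eqF// gerBl exprn_ge0.
elim: k => [|k IH]; first by rewrite addn0 subrr normr0 expr0 subrr mul0r mulr0.
rewrite addnS {1}/qpart big_ord_recr/= -/(qpart (n + k) y).
set A := qpart (n + k) y in IH *.
have -> : A * (1 - y * q ^+ (n + k)) - qpart n y = (A - qpart n y) - A * (y * q ^+ (n + k)).
  by ring.
have -> : B * `|y| * `|q| ^+ n * ((1 - `|q| ^+ k.+1) / (1 - `|q|)) =
  B * `|y| * `|q| ^+ n * ((1 - `|q| ^+ k) / (1 - `|q|)) + B * (`|y| * (`|q| ^+ n * `|q| ^+ k)).
  by rewrite exprS; field; rewrite gt_eqF.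
apply: (le_trans (ler_normB _ _)); rewrite lerD//.
rewrite !normrM normrX exprD; apply: ler_wpM2r; last exact: BP.
by rewrite !mulr_ge0 ?exprn_ge0.
Qed.

Lemma qpart_cvg y : (fun n => qpart n y : C^o) @ \oo --> (qpoch q y : C^o).
Proof.
have y1 : 0 < `|y| + 1 by rewrite ltr_wpDl.
suff : cvgn (fun n => qpart n y : C^o) by [].
apply: complex_cauchy_cvg => e e0; have [K K0 KP] := qpart_diff y1.
have Ky : 0 < K * (`|y| + 1) by rewrite mulr_gt0.
have eK : 0 < e / (K * (`|y| + 1)) by rewrite divr_gt0.
have [n nP] := expr_norm_small eK.
exists n => m /subnKC <-; apply: (le_lt_trans (KP _ _ _ _)); first by rewrite lerDl.
have := nP n (leqnn n); rewrite ltr_pdivlMr// => h; apply: le_lt_trans h.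
rewrite mulrC; apply: ler_wpM2l; first exact: exprn_ge0.
by rewrite ler_wpM2l ?lerDl// ltW.
Qed.

Lemma qpart_unif (M e : C) : 0 < M -> 0 < e -> exists n, forall m y, (n <= m)%N ->
  `|y| <= M -> `|qpart m y - qpoch q y| < e.
Proof.
move=> M0 e0; have [K K0 KP] := qpart_diff M0.
have KM : 0 < K * M by rewrite mulr_gt0.
have e20 : 0 < e / 2 by rewrite divr_gt0.
have eK : 0 < e / 2 / (K * M) by rewrite divr_gt0.
have [n nP] := expr_norm_small eK.
exists n => m y nm yM.
have /cvgrPdist_lt/(_ _ e20)[l _ lP] := @qpart_cvg y.
(* The index l depends on y, but passing from m to m + l costs an amount controlled by m alone. *)
have := lP (m + l)%N; rewrite /= leq_addl => /(_ isT) h.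
rewrite distrC -(subrK (qpart (m + l) y) (qpoch q y)) -addrA.
rewrite (le_lt_trans (ler_normD _ _))// [ltRHS]splitr ltrD//.
apply: (le_lt_trans (KP _ _ _ yM)).
have := nP m nm; rewrite ltr_pdivlMr// => h'; apply: le_lt_trans h'.
rewrite mulrC; apply: ler_wpM2l; first exact: exprn_ge0.
by rewrite ler_wpM2l// ltW.
Qed.

Lemma qpochS y : qpoch q y = (1 - y) * qpoch q (q * y).
Proof.
have h1 : (fun n => qpart n.+1 y : C^o) @ \oo --> (qpoch q y : C^o).
  by rewrite (cvg_shiftS (fun n => qpart n y : C^o)); exact: qpart_cvg.
have h2 : (fun n => (1 - y) * qpart n (q * y) : C^o) @ \oo -->
    ((1 - y) * qpoch q (q * y) : C^o).
  by apply: cvgM; [exact: cvg_cst|exact: qpart_cvg].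
apply: (cvg_unique _ h1); first exact: norm_hausdorff.
suff -> : (fun n => qpart n.+1 y) = (fun n => (1 - y) * qpart n (q * y)) by [].
apply/funext => n; rewrite -add1n qpartD expr1 /qpart big_ord1 expr0 mulr1.
by rewrite mulrC [y * q]mulrC mulrC.
Qed.

(** This makes the weight vanish where x^2 = 1 or x^2 = q, the points at which the formulas for [T1]
    and [T0] say nothing. *)
Lemma qpoch1 : qpoch q 1 = 0.
Proof. by rewrite qpochS subrr mul0r. Qed.

Lemma qpart_asymptotic (z : R -> C) (M : C) : 0 < M ->
  (forall t, 0 <= t <= 1 -> `|z t| <= M) ->
  asymptotic unif_filter (fun w => qpart w.1 (z w.2)) (fun w => qpoch q (z w.2)).
Proof.
move=> M0 zM; have [B B0 BP] := qpart_bounded M0.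
have bP : bounded_along unif_filter (fun w => qpart w.1 (z w.2)).
  by exists B => //; exists 0%N => n t _ t01; exact/BP/zM.
split=> //.
- exists (B + 1); first by rewrite addr_gt0.
  have [n nP] := qpart_unif M0 ltr01; exists n => m t nm t01 /=.
  rewrite -(subrK (qpart m (z t)) (qpoch _ _)) (le_trans (ler_normD _ _))// addrC.
  by rewrite lerD ?BP ?zM// distrC ltW// nP// zM.
- move=> e e0; have [n nP] := qpart_unif M0 e0.
  by exists n => m t nm t01; apply: nP => //; exact: zM.
Qed.

(* Only finitely many factors can be small on the curve: the product of the other ones
   is within 1/2 of 1. *)
Lemma qpart_asymptoticV (z : R -> C) (M : C) : 0 < M ->
  (forall t, 0 <= t <= 1 -> `|z t| <= M) ->
  (forall j, exists2 m : C, 0 < m & forall t, 0 <= t <= 1 -> m <= `|1 - z t * q ^+ j|) ->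
  asymptotic unif_filter (fun w => (qpart w.1 (z w.2))^-1) (fun w => (qpoch q (z w.2))^-1).
Proof.
move=> M0 zM zm; have [K K0 KP] := qpart_diff M0; case/andP: hq => q0 q1.
have KM : 0 < K * M by rewrite mulr_gt0.
have eK : 0 < 2^-1 / (K * M) by rewrite divr_gt0// invr_gt0.
have [n nP] := expr_norm_small eK.
have [m m0 mP] : exists2 m : C, 0 < m & forall t, 0 <= t <= 1 -> m <= `|qpart n (z t)|.
  elim: n {nP} => [|n [m m0 mP]].
    by exists 1 => // t _; rewrite /qpart big_ord0 normr1.
  have [m' m'0 m'P] := zm n; exists (m * m'); first exact: mulr_gt0.
  move=> t t01; rewrite /qpart big_ord_recr normrM ler_pM ?mP ?m'P//; exact: ltW.
have low k t : (n <= k)%N -> 0 <= t <= 1 -> m / 2 <= `|qpart k (z t)|.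
  move=> /subnKC <- t01; rewrite qpartD normrM; apply: ler_pM; rewrite ?mP ?invr_ge0//; first exact: ltW.
  have zq : `|z t * q ^+ n| <= M * `|q| ^+ n.
    by rewrite normrM normrX ler_wpM2r ?exprn_ge0// zM.
  have zqM : `|z t * q ^+ n| <= M.
    apply: (le_trans zq); apply: ler_piMr; first exact: ltW.
    by apply: exprn_ile1 => //; exact: ltW.
  have := KP _ 0%N (k - n)%N zqM; rewrite add0n expr0 mulr1 {2}/qpart big_ord0.
  set P := qpart _ _ => h.
  have h2 : `|P - 1| <= 2^-1.
    apply: (le_trans h); have := nP n (leqnn n); rewrite ltr_pdivlMr// => /ltW.
    apply: le_trans; rewrite [leRHS](_ : _ = K * (M * `|q| ^+ n)); last by ring.
    by apply: ler_wpM2l => //; exact: ltW.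
  have := ler_distD P 1 0; rewrite subr0 normr1 subr0 -lerBlDl => h3.
  apply: le_trans h3; rewrite distrC.
  have -> : 2^-1 = 1 - 2^-1 :> C by field.
  by rewrite lerD2l lerN2.
(* Truncations are at least m/2 in absolute value, and the limit may lose another m/4. *)
have m40 : 0 < m / 4 by rewrite divr_gt0.
apply: (asymptoticV m40 _ _ (qpart_asymptotic M0 zM)).
- exists n => k t nk t01 /=; apply: le_trans (low k t nk t01).
  apply: ler_wpM2l; first exact: ltW.
  by rewrite lef_pV2 ?posrE// ler_nat.
- have [l lP] := qpart_unif M0 m40; exists 0%N => _ t _ t01 /=.
  have h1 := low _ _ (leq_maxl n l) t01; have h2 := lP _ (z t) (leq_maxr n l) (zM _ t01).
  have := ler_distD (qpoch q (z t)) (qpart (maxn n l) (z t)) 0; rewrite !subr0 -lerBlDl.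
  apply: le_trans; have -> : m / 4 = m / 2 - m / 4 by field.
  by apply: lerB => //; exact: ltW.
Qed.

End QPochhammer.

(** * Symmetric kernels *)

Section Kernel.
Variable R : realType.
Local Notation C := (complex R).
Variable gamma : R -> C^o.
Hypothesis gammaJ : jordan_curve gamma.
Variables (q p alpha : C) (es : seq C).
Hypothesis hq : 0 < `|q| < 1.
Hypothesis p0 : p != 0.
Hypothesis winds0 : winds gamma 0 1.
Hypothesis esP : forall e j, e \in es ->
  [/\ e != 0, winds gamma (e * q ^+ j)^-1 0 & winds gamma (e * p * q ^+ j) 1].

Let gamma_cont : {within `[0, 1], continuous gamma}. Proof. by case: gammaJ. Qed.
Let gamma_rect : rectifiable gamma. Proof. by case: gammaJ. Qed.

Let q0 : q != 0. Proof. by rewrite -normr_gt0; case/andP: hq. Qed.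

(** [P] is either the truncated or the infinite product. The denominators vanish at the two families
    of points in [esP]. [T1] takes p = 1, alpha = q, and [T0] takes p = q, alpha = 1. *)
Definition symmetric_kernel (P : C -> C) x : C :=
  P (alpha * x ^+ 2) * P (alpha * p ^+ 2 / x ^+ 2) *
  \prod_(e <- es) ((P (e * x))^-1 * (P (e * p / x))^-1).

Lemma symmetric_kernel_invol P x : x != 0 ->
  symmetric_kernel P (p / x) = symmetric_kernel P x.
Proof.
move=> x0; rewrite /symmetric_kernel; congr (_ * _).
  rewrite mulrC; congr (P _ * P _); field; rewrite ?x0 ?p0//.
apply: eq_bigr => e _; rewrite mulrC; congr ((P _)^-1 * (P _)^-1); field; rewrite ?x0 ?p0//.
Qed.

Let Pole := sym_pole gamma p.

Let Pole0 r : Pole r -> r != 0. Proof. by case. Qed.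

Let esl e j : e \in es -> Pole (e * q ^+ j)^-1.
Proof.
move=> ees; have [e0 h1 h2] := esP j ees; split; first by rewrite invr_eq0 mulf_neq0 ?expf_neq0.
exists 0; rewrite subr0 invrK; split=> //.
by rewrite mulrA [p * e]mulrC.
Qed.

Let esr e j : e \in es -> Pole (e * p * q ^+ j).
Proof.
move=> ees; have [e0 h1 h2] := esP j ees; split; first by rewrite !mulf_neq0 ?expf_neq0.
exists 1; rewrite subrr; split=> //.
suff -> : p / (e * p * q ^+ j) = (e * q ^+ j)^-1 by [].
by have := expf_neq0 j q0; move: (q ^+ j) => y y0; field; rewrite e0 y0 p0.
Qed.

Lemma pfrac_prod_seq (I : eqType) (r : seq I) (u : I -> C -> C) G :
  (forall i F, i \in r -> pfrac Pole F -> pfrac Pole (fun x => u i x * F x)) ->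
  pfrac Pole G -> pfrac Pole (fun x => (\prod_(i <- r) u i x) * G x).
Proof.
elim: r => [|i r IH] ur pG.
  by apply: pfrac_ext pG => x _ _; rewrite big_nil mul1r.
have {}IH : pfrac Pole (fun x => (\prod_(j <- r) u j x) * G x).
  by apply: IH => // j F jr; apply: ur; rewrite inE jr orbT.
apply: pfrac_ext (ur i _ (mem_head _ _) IH) => x _ _.
by rewrite big_cons mulrA.
Qed.

(** The factors are multiplied in one at a time. Those in the numerator are 1 - c x^(2 or -2); each
    one in a denominator is, up to a unit of the Laurent polynomials, x - r with r a [sym_pole]. *)
Lemma pfrac_symmetric_kernel n (h : laurent R) :
  pfrac Pole (fun x => symmetric_kernel (qpart q n) x * ev h x).
Proof.
have pX (c : C) (m : int) F : pfrac Pole F -> pfrac Pole (fun x => (1 - c * x ^ m) * F x).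
  move=> pF; apply: pfrac_ext (pfrac_lin (- c) (pfrac_mulXz Pole0 m pF) pF) => x _ _.
  ring.
have ph : pfrac Pole (ev h).
  apply: pfrac_ext (pfrac_mul_ev Pole0 h (pfrac_exp Pole 0)) => x _ _.
  by rewrite expr0z mulr1.
have qpartE y : qpart q n y = \prod_(j <- index_enum 'I_n) (1 - y * q ^+ j) by [].
have p1 : pfrac Pole (fun x => \prod_(e <- es)
    ((qpart q n (e * x))^-1 * (qpart q n (e * p / x))^-1) * ev h x).
  apply: pfrac_prod_seq => // e F ees pF.
  apply: (@pfrac_ext _ _ (fun x => (\prod_(j <- index_enum 'I_n) (1 - e * x * q ^+ j)^-1) *
      ((\prod_(j <- index_enum 'I_n) (1 - e * p / x * q ^+ j)^-1) * F x))).
    by move=> x _ _; rewrite mulrA !qpartE -!prodfV.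
  apply: pfrac_prod_seq => [j {}F _ {}pF|].
    have [e0 _ _] := esP j ees.
    apply: pfrac_ext (pfracZ (- (e * q ^+ j)^-1) (pfrac_mul_pole Pole0 (esl j ees) pF)) => x x0 Px.
    have := expf_neq0 j q0; move: (q ^+ j) (esl j ees) => y yP y0.
    have d0 : x - (e * y)^-1 != 0.
      by rewrite subr_eq0; apply/eqP => E; apply: Px; rewrite E.
    have -> : 1 - e * x * y = - (e * y) * (x - (e * y)^-1) by field; rewrite e0 y0.
    by rewrite [(- (e * y) * _)^-1]invfM invrN mulrA.
  apply: pfrac_prod_seq => [j {}F _ {}pF|//].
  apply: pfrac_ext (pfrac_mulX (pfrac_mul_pole Pole0 (esr j ees) pF)) => x x0 Px.
  have d0 : x - e * p * q ^+ j != 0.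
    by rewrite subr_eq0; apply/eqP => E; apply: Px; rewrite E; exact: esr.
  have -> : 1 - e * p / x * q ^+ j = (x - e * p * q ^+ j) * x^-1 by field.
  by rewrite [(_ * x^-1)^-1]invfM invrK mulrCA mulrA [_ * x]mulrC.
apply: (@pfrac_ext _ _ (fun x => (\prod_(j <- index_enum 'I_n) (1 - alpha * x ^+ 2 * q ^+ j)) *
      ((\prod_(j <- index_enum 'I_n) (1 - alpha * p ^+ 2 / x ^+ 2 * q ^+ j)) *
      (\prod_(e <- es)
    ((qpart q n (e * x))^-1 * (qpart q n (e * p / x))^-1) * ev h x)))).
  by move=> x _ _; rewrite /symmetric_kernel !mulrA -!qpartE.
apply: pfrac_prod_seq => [j F _ pF|].
  by apply: pfrac_ext (pX (alpha * q ^+ j) 2 _ pF) => x _ _; congr ((1 - _) * _); rewrite mulrAC.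
apply: pfrac_prod_seq => [j F _ pF|//].
apply: pfrac_ext (pX (alpha * p ^+ 2 * q ^+ j) (- 2%:Z) _ pF) => x _ _.
by congr ((1 - _) * _); rewrite mulrAC -exprnN.
Qed.

Let curve_inv_bounded : exists2 M : C, 0 < M &
  forall t, 0 <= t <= 1 -> `|(gamma t)^-1 : C| <= M.
Proof.
have [m m0 mP] := curve_away gamma_cont winds0.1.
have mC : 0 < m%:C%C :> C by rewrite realC_gt0.
exists (m%:C%C)^-1; first by rewrite invr_gt0.
move=> t t01; have := mP t t01; rewrite subr0 normfV => h.
by rewrite lef_pV2 ?posrE// (lt_le_trans mC).
Qed.

Lemma bounded_ev_curve (h : laurent R) :
  bounded_along unif_filter (fun w => ev h (gamma w.2)) /\
  bounded_along unif_filter (fun w => ev h (p / gamma w.2)).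
Proof.
have [M M0 MP] := curve_bounded gamma_cont; have [N N0 NP] := curve_inv_bounded.
have b1 : bounded_along unif_filter (fun w => gamma w.2 : C).
  by exists M => //; exists 0%N => n t _ /MP.
have b2 : bounded_along unif_filter (fun w => (gamma w.2)^-1 : C).
  by exists N => //; exists 0%N => n t _ /NP.
have bX (u : nat * R -> C) n : bounded_along unif_filter u ->
    bounded_along unif_filter (fun w => u w ^+ n).
  by move=> bu; have [+ _ _] := asymptoticX n (asymptotic_refl bu).
have bE (u : nat * R -> C) : bounded_along unif_filter u ->
    bounded_along unif_filter (fun w => (u w)^-1) ->
    bounded_along unif_filter (fun w => ev h (u w)).
  move=> bu bV; rewrite /ev.
  suff E (s : seq int) : bounded_along unif_filter
      (fun w => \sum_(n <- s) mcoeff n h * u w ^ n) by exact: E.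
  elim: s => [|n s IH].
    by under eq_fun do rewrite big_nil; exact: bounded_along_cst.
  under eq_fun do rewrite big_cons.
  apply: bounded_alongD IH; apply: bounded_alongM; first exact: bounded_along_cst.
  case: n => n; first exact: bX.
  by under eq_fun do rewrite NegzE -exprnN -exprVn; exact: bX.
split; first exact: bE.
apply: bE; first by apply: bounded_alongM => //; exact: bounded_along_cst.
by under eq_fun do rewrite invf_div; apply: bounded_alongM => //; exact: bounded_along_cst.
Qed.

Lemma symmetric_kernel_asymptotic : asymptotic unif_filter
  (fun w => symmetric_kernel (qpart q w.1) (gamma w.2))
  (fun w => symmetric_kernel (qpoch q) (gamma w.2)).
Proof.
have [M M0 MP] := curve_bounded gamma_cont; have [N N0 NP] := curve_inv_bounded.
have bZ (c B : C) : 0 < B -> 0 < (`|c| + 1) * B.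
  by move=> B0; rewrite mulr_gt0// ltr_wpDl.
have bP (c B z : C) : `|z| <= B -> `|c * z| <= (`|c| + 1) * B.
  by move=> zB; rewrite normrM ler_pM// lerDl.
rewrite /symmetric_kernel; apply: asymptoticM; first apply: asymptoticM.
- apply: (@qpart_asymptotic _ _ hq (fun t => alpha * (gamma t : C) ^+ 2) _ (bZ alpha (M ^+ 2) (exprn_gt0 2 M0))) => t t01.
  by apply: bP; rewrite normrX lerXn2r ?nnegrE ?MP// ltW.
- apply: (@qpart_asymptotic _ _ hq (fun t => alpha * p ^+ 2 / (gamma t : C) ^+ 2) _ (bZ (alpha * p ^+ 2) (N ^+ 2) (exprn_gt0 2 N0))) => t t01.
  by apply: bP; rewrite -exprVn normrX lerXn2r ?nnegrE ?NP// ltW.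
elim: es esP => [|e s IH] sP.
  by apply: asymptotic_eq (asymptotic_cst 1); apply: nearW => w; rewrite !big_nil.
have {}IH := IH (fun x j xs => sP x j (mem_behead (s := e :: s) xs)).
have eP j := sP e j (mem_head _ _); have [e0 _ _] := eP 0%N.
have e1 := @qpart_asymptoticV _ _ hq (fun t => e * gamma t) _ (bZ e M M0) (fun t t01 => bP e _ _ (MP t t01)).
have e2 := @qpart_asymptoticV _ _ hq (fun t => e * p / gamma t) _ (bZ (e * p) N N0) (fun t t01 => bP (e * p) _ _ (NP t t01)).
apply: asymptotic_eq (asymptoticM (asymptoticM (e1 _) (e2 _)) IH).
- by apply: nearW => w; rewrite !big_cons.
- move=> j; have [_ [h _] _] := eP j; have [m m0 mP] := curve_away gamma_cont h.
  have eq0 : e * q ^+ j != 0 by rewrite mulf_neq0 ?expf_neq0.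
  exists (`|e * q ^+ j| * m%:C%C); first by rewrite mulr_gt0 ?normr_gt0 ?realC_gt0.
  move=> t t01; have := mP t t01; rewrite -(ler_pM2l (_ : 0 < `|e * q ^+ j|)) ?normr_gt0//.
  rewrite -normrM mulrBr divff// => /le_trans; apply.
  by rewrite distrC mulrAC.
- move=> j; have [_ _ [h _]] := eP j; have [m m0 mP] := curve_away gamma_cont h.
  have mC : 0 < m%:C%C :> C by rewrite realC_gt0.
  exists (m%:C%C / M); first by rewrite divr_gt0.
  move=> t t01; have [w0 _] := winds0.
  have x0 : gamma t != 0 :> C.
    by apply/eqP => E; apply: w0; exists t; rewrite //= in_itv.
  have -> : 1 - e * p / gamma t * q ^+ j = (gamma t - e * p * q ^+ j) * (gamma t)^-1 :> C by field.
  rewrite normrM ler_pM ?mP ?invr_ge0//; [exact: ltW|exact: ltW|].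
  by rewrite normfV lef_pV2 ?posrE ?normr_gt0// MP.
Qed.

Lemma is_contour_integral_symmetric (h : laurent R) : is_contour_integral gamma
  (fun x => symmetric_kernel (qpoch q) x * ((ev h x - ev h (p / x)) / x)) 0.
Proof.
pose F_ n x := symmetric_kernel (qpart q n) x * ((ev h x - ev h (p / x)) / x).
apply: (@is_contour_integral_unif _ _ gamma_rect F_) => [e e0|n]; last first.
  (* By invariance of the truncated kernel, the integrand is (G(x) - G(p/x))/x with G the kernel
     times h. *)
  have := pfrac_symmetric gammaJ p0 winds0 (pfrac_symmetric_kernel n h).
  apply: is_contour_integral_ext => // t t01.
  rewrite /F_ symmetric_kernel_invol ?mulrA ?mulrBr//.
  by apply/eqP => E; apply: winds0.1; exists t; rewrite //= in_itv.
have [b1 b2] := bounded_ev_curve h; have [N N0 NP] := curve_inv_bounded.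
have b3 : bounded_along unif_filter (fun w => (gamma w.2)^-1 : C).
  by exists N => //; exists 0%N => n t _ /NP.
have b : bounded_along unif_filter
    (fun w => (ev h (gamma w.2) - ev h (p / gamma w.2)) / gamma w.2 : C).
  apply: (bounded_alongM _ b3); apply: (bounded_alongD b1 _).
  have [M M0 MP] := b2; exists M => //; apply: filterS MP => w.
  by rewrite normrN.
have [_ _] := asymptoticM symmetric_kernel_asymptotic (asymptotic_refl b).
exact.
Qed.

End Kernel.

(** * The adjoints *)

Section Quadratic.
Variable R : realType.
Local Notation C := (complex R).
Implicit Types (f g : laurent R) (k u s q : C).

(** This is (T - k)(T + k^-1) = 0. The excluded set x^2 = 1 is stable under inversion, so [T1P]
    applies at x and at 1/x and leaves a rational identity in f(x) and f(1/x). *)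
Lemma T1_quadratic k u f : k != 0 -> u != 0 ->
  T1 k u (T1 k u f) = (k - k^-1) *: T1 k u f + f.
Proof.
move=> k0 u0; apply: (@ev_inj_off _ 1) => x x0 x1.
have y0 : x^-1 != 0 by rewrite invr_eq0.
have y1 : x^-1 ^+ 2 != 1 by rewrite exprVn invr_eq1.
rewrite evD evZ (T1P k u (T1 k u f))// !T1P// invrK.
have d1 : 1 - x ^+ 2 != 0 by rewrite subr_eq0 eq_sym.
have d2 : x ^+ 2 - 1 != 0 by rewrite subr_eq0.
by field; rewrite x0 d1 d2 u0 k0.
Qed.

Lemma T0_quadratic s q k u f : s != 0 -> s ^+ 2 = q -> k != 0 -> u != 0 ->
  T0 s q k u (T0 s q k u f) = (k - k^-1) *: T0 s q k u f + f.
Proof.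
move=> s0 <- k0 u0; apply: (@ev_inj_off _ (s ^+ 2)) => x x0 x1.
have y0 : s ^+ 2 / x != 0 by rewrite mulf_neq0 ?invr_eq0 ?expf_neq0.
have d1 : x ^+ 2 - s ^+ 2 != 0 by rewrite subr_eq0.
have d2 : s ^+ 2 - x ^+ 2 != 0 by rewrite subr_eq0 eq_sym.
have y1 : (s ^+ 2 / x) ^+ 2 != s ^+ 2.
  rewrite -subr_eq0 (_ : _ - _ = s ^+ 2 * (s ^+ 2 - x ^+ 2) / x ^+ 2); last by field.
  by rewrite !mulf_neq0 ?invr_eq0 ?expf_neq0.
rewrite evD evZ (@T0P _ s (s ^+ 2) k u (T0 s (s ^+ 2) k u f))// !T0P//.
have -> : s ^+ 2 / (s ^+ 2 / x) = x by field; rewrite s0 x0.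
by field; rewrite x0 u0 k0 s0 d1 d2.
Qed.

(** The relation is that of a primed operator, whose parameter is k^-1; it reads T (T + k - k^-1) =
    1. *)
Lemma quadratic_inverse (T : {linear laurent R -> laurent R}) k :
  (forall f, T (T f) = (k^-1 - k) *: T f + f) ->
  exists2 V : {linear laurent R -> laurent R}, is_inverse T V &
    forall f, V f = T f + (k - k^-1) *: f.
Proof.
move=> TT; exists (T \+ (k - k^-1) \*: idfun) => //; split=> f /=.
  by rewrite TT addrAC -scalerDl addrA subrK subrr scale0r add0r.
by rewrite linearD linearZ /= TT addrAC -scalerDl addrA subrK subrr scale0r add0r.
Qed.

(** The dilation comes from the primed [T0], which at 1/x evaluates g at x/q. *)
Lemma is_laurent_mul_dilate f g c : is_laurent (fun x => ev f x * ev g (x * c)).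
Proof.
suff LG (r : seq int) :
    is_laurent (fun x => ev f x * \sum_(n <- r) mcoeff n g * (x * c) ^ n) by exact: LG.
have : is_laurent (fun x => \sum_(n <- r) (mcoeff n g * c ^ n) * (x ^ n * ev f x)).
  by apply: is_laurent_sum => n; apply/is_laurentZ/is_laurentX/is_laurent_ev.
apply: is_laurent_ext => x _; rewrite mulr_sumr.
by apply: eq_bigr => n _; rewrite expfzMl; ring.
Qed.

End Quadratic.

(** * The pairing identities for the two generators *)

Section Adjoint.
Variable R : realType.
Local Notation C := (complex R).

(* [contour_integral] has the junk value 0 when there is no integral; the two sets of
   values being equal, no existence is needed. *)
Lemma eq_contour_integral (gamma : R -> C^o) (F G : C -> C) : rectifiable gamma ->
  is_contour_integral gamma (fun x => F x - G x) 0 ->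
  contour_integral gamma F = contour_integral gamma G.
Proof.
move=> gr FG; rewrite /contour_integral; congr xget; apply/seteqP; split=> I /=.
  move=> /is_contour_integralD -/(_ _ _ (is_contour_integralZ (-1) FG)).
  by rewrite mulr0 addr0; apply: is_contour_integral_ext => // t _; ring.
move=> /is_contour_integralD -/(_ _ _ FG).
by rewrite addr0; apply: is_contour_integral_ext => // t _; ring.
Qed.

Variables (gamma : R -> C^o) (q s k0 k1 u0 u1 : C).
Hypotheses (hq : 0 < `|q| < 1) (hs : s ^+ 2 = q).
Hypotheses (hk0 : k0 != 0) (hk1 : k1 != 0) (hu0 : u0 != 0) (hu1 : u1 != 0).
Variables a b c d : C.
Hypotheses (ha : a = k1 * u1) (hb : b = - (k1 * u1^-1)).
Hypotheses (hc : c = s * k0 * u0) (hd : d = - (s * k0 * u0^-1)).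
Hypotheses (gammaJ : jordan_curve gamma) (winds0 : winds gamma 0 1).
Hypothesis windsi : forall e j, e \in [:: a; b; c; d] -> winds gamma (e * q ^+ j) 1.
Hypothesis windse : forall e j, e \in [:: a; b; c; d] -> winds gamma (e^-1 * q ^- j) 0.

Let gamma_rect : rectifiable gamma. Proof. by case: gammaJ. Qed.

Let q0 : q != 0. Proof. by rewrite -normr_gt0; case/andP: hq. Qed.

Let s0 : s != 0. Proof. by have := q0; rewrite -hs expf_eq0. Qed.

Let ain : a \in [:: a; b; c; d]. Proof. by rewrite !inE eqxx. Qed.
Let bin : b \in [:: a; b; c; d]. Proof. by rewrite !inE eqxx ?orbT. Qed.
Let cin : c \in [:: a; b; c; d]. Proof. by rewrite !inE eqxx ?orbT. Qed.
Let din : d \in [:: a; b; c; d]. Proof. by rewrite !inE eqxx ?orbT. Qed.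

Let es0 e : e \in [:: a; b; c; d] -> e != 0.
Proof.
by rewrite !inE => /or4P[] /eqP->; rewrite ?ha ?hb ?hc ?hd ?oppr_eq0 !mulf_neq0 ?invr_eq0.
Qed.

Let nz t : 0 <= t <= 1 -> gamma t != 0 :> C.
Proof. by move=> t01; apply/eqP => E; apply: winds0.1; exists t; rewrite //= in_itv. Qed.

Let neq_in e t : e \in [:: a; b; c; d] -> 0 <= t <= 1 -> 1 - e / gamma t != 0 :> C.
Proof.
move=> ees t01; have [eP _] := windsi 0 ees; rewrite subr_eq0; apply/eqP => E; apply: eP.
exists t; first by rewrite /= in_itv.
by rewrite expr0 mulr1 -[LHS]mul1r E divfK// nz.
Qed.

Let neq_ex e t : e \in [:: a; b; c; d] -> 0 <= t <= 1 -> 1 - e * gamma t != 0 :> C.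
Proof.
move=> ees t01; have [eP _] := windse 0 ees; rewrite subr_eq0; apply/eqP => E; apply: eP.
exists t; first by rewrite /= in_itv.
by rewrite expr0 invr1 mulr1 -[LHS](mulKf (es0 ees)) -E mulr1.
Qed.

Lemma T1_pairing f g : pairing q a b c d gamma (T1 k1 u1 f) g =
  pairing q a b c d gamma f (T1 k1^-1 u1^-1 g + (k1 - k1^-1) *: g).
Proof.
rewrite /pairing; congr (_ * _); apply: eq_contour_integral => //.
have [h hE] := is_laurent_mul_dilate f g 1.
(* The weight already carries q a, q b in its factors in 1/x; cancelling 1 - a x and 1 - b x brings
   the factors in x to the same shift. *)
have kP e j : e \in [:: q * a; q * b; c; d] ->
    [/\ e != 0, winds gamma (e * q ^+ j)^-1 0 & winds gamma (e * 1 * q ^+ j) 1].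
  have m e' i : e' \in [:: a; b; c; d] -> [/\ e' * q ^+ i != 0,
      winds gamma (e' * q ^+ i)^-1 0 & winds gamma (e' * q ^+ i) 1].
    move=> ees; rewrite invfM; split; [|exact: windse|exact: windsi].
    exact: mulf_neq0 (es0 ees) (expf_neq0 _ q0).
  rewrite mulr1 !inE => /or4P[] /eqP->.
  - have [_ ? ?] := m a j.+1 ain; rewrite [q * a]mulrC -(mulrA a) -exprS; split=> //.
    exact: mulf_neq0 (es0 ain) q0.
  - have [_ ? ?] := m b j.+1 bin; rewrite [q * b]mulrC -(mulrA b) -exprS; split=> //.
    exact: mulf_neq0 (es0 bin) q0.
  - by have [_ ? ?] := m c j cin; split=> //; exact: es0.
  - by have [_ ? ?] := m d j din; split=> //; exact: es0.
have := is_contour_integral_symmetric gammaJ q hq (oner_neq0 C) winds0 kP h.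
(* k1^-1 is the coefficient of the reflection part of [T1]; the sign is there because h(1/x) - h(x)
   appears. *)
move=> /(is_contour_integralZ (- k1^-1)); rewrite mulr0.
apply: is_contour_integral_ext => // t t01.
have x0 := nz t01.
have na : 1 - a * gamma t != 0 :> C by exact: neq_ex.
have nb : 1 - b * gamma t != 0 :> C by exact: neq_ex.
move: (gamma t : C) x0 na nb => x x0 na nb.
have y0 : x^-1 != 0 by rewrite invr_eq0.
rewrite evD evZ.
have [x1|x1] := eqVneq (x ^+ 2) 1.
  have xV : x^-1 = x.
    by apply: (mulfI x0); rewrite divff// -expr2 x1.
  rewrite /weight /qpochs !big_cons x1 qpoch1// !(mul0r, mulr0).
  by rewrite mul1r xV subrr !(mul0r, mulr0) subrr.
have y1 : x^-1 ^+ 2 != 1 by rewrite exprVn invr_eq1.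
rewrite !T1P// !hE ?mul1r// invrK !mulr1 /symmetric_kernel /weight /qpochs.
rewrite !big_cons !big_nil !mulr1.
rewrite (qpochS hq (x ^+ 2)) (qpochS hq (a * x)) (qpochS hq (b * x)).
rewrite !expr1n !mulr1.
rewrite -!(mulrA q) !(mulrA q a) !(mulrA q b).
have d1 : 1 - x ^+ 2 != 0 by rewrite subr_eq0 eq_sym.
have d2 : x ^+ 2 - 1 != 0 by rewrite subr_eq0.
rewrite !invfM.
(* Once the first factors are split off, the infinite products on both sides are the same;
   generalizing them leaves an identity of rational functions. *)
move: (qpoch q _) (qpoch q _) (qpoch q _)^-1 (qpoch q _)^-1 (qpoch q _)^-1 (qpoch q _)^-1
  (qpoch q _)^-1 (qpoch q _)^-1 (qpoch q _)^-1 (qpoch q _)^-1.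
move=> P Q i1 i2 i3 i4 i5 i6 i7 i8; rewrite !invrK.
move: na nb; rewrite ha hb => na nb.
have {}nb : u1 - - k1 * x != 0.
  apply: contraNneq nb => E.
  rewrite (_ : 1 - _ = (u1 - - k1 * x) / u1); last by field.
  by rewrite E mul0r.
by field; rewrite x0 hu1 nb na hk1 d2 d1.
Qed.

Lemma T0_pairing f g : pairing q a b c d gamma (T0 s q k0 u0 f) g =
  pairing q a b c d gamma f (T0 s^-1 q^-1 k0^-1 u0^-1 g + (k0 - k0^-1) *: g).
Proof.
rewrite /pairing; congr (_ * _); apply: eq_contour_integral => //.
have [h hE] := is_laurent_mul_dilate f g q^-1.
have kP e j : e \in [:: a; b; c; d] ->
    [/\ e != 0, winds gamma (e * q ^+ j)^-1 0 & winds gamma (e * q * q ^+ j) 1].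
  move=> ees; rewrite invfM -mulrA -exprS.
  by split; [exact: es0|exact: windse|exact: windsi].
have := is_contour_integral_symmetric gammaJ 1 hq q0 winds0 kP h.
move=> /(is_contour_integralZ (- k0^-1)); rewrite mulr0.
apply: is_contour_integral_ext => // t t01.
have x0 := nz t01.
have nc : 1 - c / gamma t != 0 :> C by exact: neq_in.
have nd : 1 - d / gamma t != 0 :> C by exact: neq_in.
move: (gamma t : C) x0 nc nd => x x0 nc nd.
have y0 : x^-1 != 0 by rewrite invr_eq0.
have qx0 : q / x != 0 by rewrite mulf_neq0.
rewrite evD evZ.
(* At these points q/x = x and (q/x^2; q) = (1; q) = 0, so both sides vanish again. *)
have [x1|x1] := eqVneq (x ^+ 2) q.
  have qxE : q / x = x by rewrite -x1 expr2 mulfK.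
  have qxE2 : q / x ^+ 2 = 1 by rewrite x1 divff.
  rewrite /weight /qpochs !big_cons qxE2 qpoch1// !(mul0r, mulr0).
  by rewrite qxE !subrr !(mul0r, mulr0).
have y1 : x^-1 ^+ 2 != q^-1 by rewrite exprVn (inj_eq invr_inj).
rewrite T0P// T0P// !hE// /symmetric_kernel /weight /qpochs.
have -> : q / x / q = x^-1 by field; rewrite q0 x0.
have -> : q^-1 / x^-1 = x / q by rewrite invrK mulrC.
rewrite !big_cons !big_nil !mulr1 !mul1r.
(* Absorbing 1 - c/x and 1 - d/x shifts c, d to q c, q d in the factors in 1/x, so that each of the
   four parameters e gets the pair e x, q e/x. *)
rewrite (qpochS hq (q / x ^+ 2)) (qpochS hq (c / x)) (qpochS hq (d / x)).
have -> : q ^+ 2 / x ^+ 2 = q * (q / x ^+ 2) by rewrite mulrA -expr2.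
have E e : q * (e / x) = e * q / x by rewrite mulrA [q * e]mulrC.
rewrite !E ![q * a]mulrC ![q * b]mulrC !invfM.
have d1 : x ^+ 2 - q != 0 by rewrite subr_eq0.
have d2 : q - x ^+ 2 != 0 by rewrite subr_eq0 eq_sym.
move: (qpoch q _) (qpoch q _) (qpoch q _)^-1 (qpoch q _)^-1 (qpoch q _)^-1 (qpoch q _)^-1
  (qpoch q _)^-1 (qpoch q _)^-1 (qpoch q _)^-1 (qpoch q _)^-1.
move=> P Q i1 i2 i3 i4 i5 i6 i7 i8; rewrite !invrK.
move: (ev f _) (ev f _) (ev g _) (ev g _) => v1 v2 v3 v4.
move: nc nd d1 d2; rewrite hc hd -hs => nc nd d1 d2.
have {}nc : x - s * k0 * u0 != 0.
  apply: contraNneq nc => z0.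
  rewrite (_ : 1 - _ = (x - s * k0 * u0) / x); last by field.
  by rewrite z0 mul0r.
have {}nd : u0 * x - - (s * k0) != 0.
  apply: contraNneq nd => z0.
  rewrite (_ : 1 - _ = (u0 * x - - (s * k0)) / (u0 * x)); last by field; rewrite x0 hu0.
  by rewrite z0 mul0r.
rewrite expr2 in d1 d2.
by field; rewrite x0 hu0 nd nc hk0 s0 d2 d1.
Qed.

End Adjoint.

Theorem proposition6p6 (R : realType) (q s k0 k1 u0 u1 a b c d : complex R)
    (gamma : R -> (complex R)^o)
    (hq : 0 < `|q| < 1) (hs : s ^+ 2 = q)
    (hk0 : k0 != 0) (hk1 : k1 != 0) (hu0 : u0 != 0) (hu1 : u1 != 0)
    (hk0u1 : forall (e : complex R) (j : int), e \in [:: k0; k1; u1] ->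
       e ^+ 2 <> q ^ j /\ e ^+ 2 <> - q ^ j)
    (ha : a = k1 * u1) (hb : b = - (k1 * u1^-1))
    (hc : c = s * k0 * u0) (hd : d = - (s * k0 * u0^-1))
    (habcd : forall (e f : complex R) (j : int),
       e \in [:: a; b; c; d] -> f \in [:: a; b; c; d] -> e * f <> q ^ j)
    (hJ : jordan_curve gamma) (hccw : counterclockwise gamma)
    (hin : forall (e : complex R) (k : nat), e \in [:: a; b; c; d] ->
       jordan_interior gamma (e * q ^+ k))
    (hin0 : jordan_interior gamma 0)
    (hex : forall (e : complex R) (k : nat), e \in [:: a; b; c; d] ->
       jordan_exterior gamma (e^-1 * q ^- k)) :
  let S0 : {linear laurent R -> laurent R} := T0 s q k0 u0 in
  let S1 : {linear laurent R -> laurent R} := T1 k1 u1 in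
  let S0' : {linear laurent R -> laurent R} := T0 s^-1 q^-1 k0^-1 u0^-1 in
  let S1' : {linear laurent R -> laurent R} := T1 k1^-1 u1^-1 in
  let Y : {linear laurent R -> laurent R} := S1 \o S0 in
  let Y' : {linear laurent R -> laurent R} := S1' \o S0' in
  let B := pairing q a b c d gamma in
  [/\ exists2 V0, is_inverse S0' V0 & is_adjoint B S0 V0,
      exists2 V1, is_inverse S1' V1 & is_adjoint B S1 V1
    & exists2 V, is_inverse Y' V & is_adjoint B Y V].

Proof.
move=> S0 S1 S0' S1' Y Y' B.
have w0 : winds gamma 0 1 by exact: winds_interior.
have wi e j : e \in [:: a; b; c; d] -> winds gamma (e * q ^+ j) 1.
  by move=> ees; apply: winds_interior => //; exact: hin.
have we e j : e \in [:: a; b; c; d] -> winds gamma (e^-1 * q ^- j) 0.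
  by move=> ees; apply: winds_exterior => //; exact: hex.
have q0 : q != 0 by rewrite -normr_gt0; case/andP: hq.
have s0 : s != 0 by have := q0; rewrite -hs expf_eq0.
have [V0 [S0V0 V0S0] V0E] : exists2 V : {linear laurent R -> laurent R},
    is_inverse S0' V & forall f, V f = S0' f + (k0 - k0^-1) *: f.
  (* Writing k0 as the inverse of k0^-1 shows k0^-1 - k0 as the coefficient k - k^-1 of the
     quadratic relation at k = k0^-1. *)
  apply: quadratic_inverse => f; rewrite -[k0 in _ - k0]invrK.
  by apply: T0_quadratic; rewrite ?invr_eq0 ?exprVn ?hs.
have [V1 [S1V1 V1S1] V1E] : exists2 V : {linear laurent R -> laurent R},
    is_inverse S1' V & forall f, V f = S1' f + (k1 - k1^-1) *: f.
  apply: quadratic_inverse => f; rewrite -[k1 in _ - k1]invrK.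
  by apply: T1_quadratic; rewrite ?invr_eq0.
have a0 : is_adjoint B S0 V0.
  by move=> f g; rewrite V0E; exact: (T0_pairing hq hs hk0 hk1 hu0 hu1 ha hb hc hd hJ w0 wi we).
have a1 : is_adjoint B S1 V1.
  by move=> f g; rewrite V1E; exact: (T1_pairing hq hs hk0 hk1 hu0 hu1 ha hb hc hd hJ w0 wi we).
(* Taking inverses and taking adjoints both reverse the order of composition, so the same operator
   serves for both. *)
split; [by exists V0|by exists V1|exists (V0 \o V1)].
- split=> f.
    exact: etrans (congr1 V0 (S1V1 (S0' f))) (S0V0 f).
  exact: etrans (congr1 S1' (V0S0 (V1 f))) (V1S1 f).
- move=> f g; exact: etrans (a1 (S0 f) g) (a0 f (V1 g)).
Qed.
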